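(* Let $d\in\mathbb{N}$ and $-d/2<\sigma<1$, $\sigma\ne0$. Then the Riesz kernel $\kappa_\sigma(x)$ is finite for every $x\in\mathbb{Z}^d$ and satisfies, as $|x|\to\infty$, \[ \kappa_\sigma(x)=C_{d,\sigma}|x|^{-d-2\sigma}+O\!\left(|x|^{-d-2\sigma-2}\right),\qquad C_{d,\sigma}=\frac{4^\sigma\Gamma(d/2+\sigma)}{\pi^{d/2}|\Gamma(-\sigma)|}. \] The constant in the Landau symbol can be chosen uniformly over the range of $\sigma$.
   Context: For $f:\mathbb{Z}^d\to\mathbb{R}$ let $\Delta f(x)=\sum_{y:|y-x|=1}(f(x)-f(y))$ ($|\cdot|$ Euclidean norm), with heat semigroup $e^{-t\Delta}$ on $\ell^2(\mathbb{Z}^d)$; $1_0$ is the indicator of $\{0\}$. The Riesz kernel is defined by $\kappa_\sigma(0)=0$ for $\sigma\in(0,1)$, and otherwise (i.e. for $\sigma<0$, and for $\sigma\in(0,1)$ at $x\ne0$) by $\kappa_\sigma(x)=\frac{1}{|\Gamma(-\sigma)|}\int_0^\infty e^{-t\Delta}1_0(x)\,\frac{dt}{t^{1+\sigma}}$. *)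

(* Defs.v *)
From HB Require Import structures.
From mathcomp Require Import all_boot all_order all_algebra.
From mathcomp Require Import all_classical all_reals all_analysis.
Set Implicit Arguments. Unset Strict Implicit. Unset Printing Implicit Defensive.
Import Order.TTheory GRing.Theory Num.Theory.
Local Open Scope classical_set_scope.
Local Open Scope ring_scope.

Section Riesz.
Variable R : realType.
Variable d : nat.

Notation pt := 'rV[int]_d.

Definition unitv (i : 'I_d) : pt := delta_mx 0 i.

Definition enorm (x : pt) : R := Num.sqrt (\sum_(i < d) ((x 0 i)%:~R) ^+ 2).

(* Graph Laplacian: Delta f(x) = sum_{|y-x|=1} (f x - f y); the neighbours of
   x in Z^d are exactly x + e_i and x - e_i, i < d. *)
Definition lap (f : pt -> R) : pt -> R :=
  fun x => \sum_(i < d) ((f x - f (x + unitv i)) + (f x - f (x - unitv i))).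

Definition ind0 : pt -> R := fun x => if x == 0 then 1 else 0.

(* e^{-t Delta} 1_0 (x): Delta is bounded on l^2(Z^d), so e^{-t Delta} is the
   norm-convergent exponential series; evaluation at x is continuous. *)
Definition heat (t : R) (x : pt) : R :=
  limn (fun N => \sum_(0 <= n < N) ((- t) ^+ n / (n`!)%:R * iter n lap ind0 x)).

(* Euler Gamma: integral for s > 0, extended by Gamma(s) = Gamma(s+1)/s
   (used only for -1 < s, s <> 0). *)
Definition Gamma_int (s : R) : R :=
  Rintegral lebesgue_measure `]0%R, +oo[ (fun t => powR t (s - 1) * expR (- t)).
Definition Gamma (s : R) : R :=
  if 0 < s then Gamma_int s else Gamma_int (s + 1) / s.

(* Riesz kernel, as an extended real (the integrand is nonnegative). *)
Definition kappa (sigma : R) (x : pt) : \bar R :=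
  if (0 < sigma < 1) && (x == 0) then 0%E
  else (((`|Gamma (- sigma)|)^-1)%:E *
       \int[lebesgue_measure]_(t in `]0%R, +oo[) (heat t x * powR t (- 1 - sigma))%:E)%E.

Definition Cconst (sigma : R) : R :=
  powR 4 sigma * Gamma (d%:R / 2 + sigma) / (powR pi (d%:R / 2) * `|Gamma (- sigma)|).

End Riesz.

(* Main.v *)
Require Import Defs.
From HB Require Import structures.
From mathcomp Require Import all_boot all_order all_algebra.
From mathcomp Require Import all_classical all_reals all_analysis.
From mathcomp Require Import measurable_realfun.
From mathcomp Require Import zify ring lra.
Import Order.TTheory GRing.Theory Num.Theory.
Import numFieldNormedType.Exports.
Set Implicit Arguments. Unset Strict Implicit. Unset Printing Implicit Defensive.
Local Open Scope classical_set_scope.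
Local Open Scope ring_scope.

(** In one dimension the heat kernel is the Fourier integral of
    exp (i n z - t (2 - 2 cos z)) over [-pi, pi]. Shifting the contour to
    Im z = lam gives, for every real lam, a solution of the discrete heat
    equation with the same initial datum and the weight e^(- lam n); uniqueness
    among exponentially bounded solutions replaces Cauchy's theorem, and also
    yields the factorization of the d-dimensional kernel. With lam = ln (4 / t)
    the kernel is O((t / 4)^|x|_1) for t <= 1. With |lam| = t^(-1/2) a comparison
    of the integrand with its Gaussian analogue gives, for t >= 1,
    p_t(x) - g_t(x) = O(t^(- d / 2 - 1) e^(- |x| / sqrt t)).
    Integrated against t^(- 1 - sigma), g_t produces exactly
    C_(d, sigma) |x|^(- d - 2 sigma) via u = |x|^2 / (4 t), and the difference is
    dominated by a multiple of |x|^(- d - 2 - 2 sigma) * a / (a + t)^2 with a = |x|^2,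
    whose integral over t is at most 1. All constants are uniform because
    1 / |Gamma (- sigma)| is bounded for sigma < 1. *)

(** * Elementary estimates *)

(** The tilt is forced by the times between 1 and |x|^2. A bound p_t - g_t = O(t^(- d / 2 - 1))
    without spatial decay, integrated against t^(- 1 - sigma), is dominated by t near 1 and gives no
    power of |x| at all. A tilt by lam gains e^(- |lam n|) when lam and n have the same sign, and
    costs at most e^(2 t (cosh lam - 1)), roughly e^(t lam^2); so |lam| = t^(-1/2) is, up to
    constants, the strongest tilt of bounded cost for t >= 1. For t <= 1 a much larger tilt is
    affordable, since lam only has to keep t cosh lam bounded. The gain 1 / t over the size of the
    kernel comes from z^2 - (2 - 2 cos z) being of fourth order: at the scale |z| = t^(-1/2) the
    exponents differ by t z^4 = 1 / t. After integration this becomes the extra factor |x|^(-2). The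
    exponential decay in |x| / sqrt t is finally spent as a power (t / |x|^2)^(d + 3), enough to
    make every integral below t = |x|^2 harmless for all sigma < 1 at once. *)

Section elementary.
Variable R : realType.
Implicit Types (x y t u a b : R) (f df : R -> R).

(** By the mean value theorem a bound of order k on the derivative gives one of order k + 1 on the
    function. Iterated along sin, cos, sinh, cosh it yields their Taylor remainders; the factor 1 /
    (k + 1) is given up so that one constant serves at every order. *)
Lemma is_derive_norm_le f df (K A : R) k : 0 <= K -> f 0 = 0 ->
  (forall x, is_derive x 1 f (df x)) ->
  (forall s, `|s| <= A -> `|df s| <= K * `|s| ^+ k) ->
  forall x, `|x| <= A -> `|f x| <= K * `|x| ^+ k.+1.
Proof.
move=> K0 f0 Hd Hb x xA.
have cf : continuous f.
  by move=> z; apply/differentiable_continuous/derivable1_diffP; apply: ex_derive.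
have key a b : a <= b -> exists2 c, a <= c <= b & f b - f a = df c * (b - a).
  move=> ab.
  have [c cab ->] := MVT_segment ab (fun z _ => Hd z) (continuous_subspaceT cf).
  by exists c => //; rewrite in_itv/= in cab.
have fin c : `|c| <= `|x| -> `|df c| * `|x| <= K * `|x| ^+ k.+1.
  move=> cx; rewrite exprSr mulrA ler_wpM2r//.
  apply: le_trans (Hb _ (le_trans cx xA)) _.
  by rewrite ler_wpM2l// lerXn2r ?nnegrE.
have [x0|x0] := lerP 0 x.
  have [c /andP[c0 cx] e] := key _ _ x0.
  rewrite f0 !subr0 in e; rewrite e normrM; apply: fin.
  by rewrite !ger0_norm.
have [c /andP[cx c0] e] := key _ _ (ltW x0).
rewrite f0 sub0r sub0r mulrN in e; move/oppr_inj : e => ->.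
rewrite normrM; apply: fin.
by rewrite !ler0_norm ?(ltW x0)// lerN2.
Qed.

Lemma norm_sin_le x : `|sin x| <= `|x|.
Proof.
rewrite -[leRHS]mul1r -[`|x|]expr1.
apply: (@is_derive_norm_le sin cos 1 `|x| 0) => //; first exact: sin0.
by move=> s _; rewrite expr0 mulr1 cos_max.
Qed.

Lemma cos_sub1_le x : `|cos x - 1| <= `|x| ^+ 2.
Proof.
rewrite -[leRHS]mul1r.
apply: (@is_derive_norm_le (fun x => cos x - 1) (fun x => - sin x) 1 `|x| 1) => //.
- by rewrite cos0 subrr.
- by move=> z; apply: is_derive_eq; rewrite /GRing.scale /=; ring.
- by move=> s _; rewrite normrN mul1r norm_sin_le.
Qed.

Lemma sin_subid_le x : `|sin x - x| <= `|x| ^+ 3.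
Proof.
rewrite -[leRHS]mul1r.
apply: (@is_derive_norm_le (fun x => sin x - x) (fun x => cos x - 1) 1 `|x| 2) => //.
- by rewrite sin0 subrr.
- by move=> s _; rewrite mul1r cos_sub1_le.
Qed.

Lemma cos_sub_taylor2_le x : `|cos x - (1 - x ^+ 2 / 2)| <= `|x| ^+ 4.
Proof.
rewrite -[leRHS]mul1r.
apply: (@is_derive_norm_le (fun x => cos x - (1 - x ^+ 2 / 2))
   (fun x => - (sin x - x)) 1 `|x| 3) => //.
- by rewrite cos0 expr0n/= mul0r !subr0 subrr.
- by move=> z; apply: is_derive_eq; rewrite /GRing.scale /= ?expr1; field.
- by move=> s _; rewrite normrN mul1r sin_subid_le.
Qed.

Lemma cos_lipschitz a b : `|cos a - cos b| <= `|a - b|.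
Proof.
rewrite -[leRHS]mul1r -[`|a - b|]expr1 -[in leLHS](subrK b a).
apply: (@is_derive_norm_le (fun s => cos (s + b) - cos b) (fun s => - sin (s + b)) 1
  `|a - b| 0) => //.
- by rewrite add0r subrr.
- by move=> z; apply: is_derive_eq; rewrite /GRing.scale /=; ring.
- by move=> s _; rewrite expr0 mulr1 normrN sin_max.
Qed.

(* Comparing the slopes of [sin] on [0, u] and on [u, pi/2] gives Jordan's
   inequality, since both are values of the decreasing function [cos]. *)
Lemma jordan_sin u : 0 <= u <= pi / 2 -> u * (2 / pi) <= sin u.
Proof.
move=> /andP[u0 up].
have p0 : 0 < pi :> R := pi_gt0 R.
have cs : continuous (@sin R) := @continuous_sin R.
have [c1] := @MVT_segment R sin cos _ _ u0 (fun z _ => @is_derive_sin R z) (continuous_subspaceT cs).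
rewrite in_itv/= => /andP[c10 c1u]; rewrite sin0 !subr0 => e1.
have [c2] := @MVT_segment R sin cos _ _ up (fun z _ => @is_derive_sin R z) (continuous_subspaceT cs).
rewrite in_itv/= => /andP[uc2 c2p]; rewrite sin_pihalf => e2.
have c21 : cos c2 <= cos c1.
  have c12 : c1 <= c2 by exact: le_trans uc2.
  move: c12; rewrite le_eqVlt => /predU1P[-> //|c12].
  apply/ltW; rewrite ltr_cos// in_itv/=; apply/andP; split; lra.
have h : 1 <= pi / 2 * cos c1.
  have h0 : 0 <= (pi/2 - u) * (cos c1 - cos c2) by rewrite mulr_ge0// subr_ge0.
  nra.
rewrite e1 mulrC ler_wpM2r// ler_pdivrMr//; lra.
Qed.

(** The half-angle formula 1 - cos u = 2 sin(u / 2)^2 and Jordan's inequality, weakened by pi <= 4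
    to sin(u / 2) >= u / 4. It supplies the Gaussian decay of the Fourier integrand over the whole
    period. *)
Lemma sub_cos_ge x : `|x| <= pi -> x ^+ 2 / 8 <= 1 - cos x.
Proof.
move=> xp; have p0 : 0 < pi :> R := pi_gt0 R.
have p4 : pi / 2 < 2 :> R := pihalf_lt2 R.
rewrite -(cos_norm x) -(real_normK (num_real x)).
move: (normr_ge0 x) xp; set u := `|x| => u0 xp.
have -> : cos u = 1 - 2 * sin (u / 2) ^+ 2.
  have e : u = u / 2 + u / 2 by field.
  rewrite {1}e cosD -expr2 cos2sin2; ring.
have := @jordan_sin (u / 2).
have -> : 0 <= u / 2 <= pi / 2 by apply/andP; split; lra.
move=> /(_ isT) h.
have h2 : u / 4 <= sin (u / 2).
  apply: le_trans h.
  have -> : u / 2 * (2 / pi) = u / pi by rewrite mulrA divfK.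
  by rewrite ler_wpM2l// lef_pV2 ?posrE//; lra.
have h3 : (u / 4) ^+ 2 <= sin (u / 2) ^+ 2.
  by rewrite lerXn2r ?nnegrE//; lra.
lra.
Qed.

Lemma expR1_le4 : expR 1 <= 4 :> R.
Proof.
have h : 2^-1 <= expR (- (2^-1)) :> R by have := expR_ge1Dx (- (2^-1) : R); lra.
have h2 : expR (2^-1) <= 2 :> R.
  by rewrite -[leRHS]invrK -[leLHS]invrK lef_pV2 ?posrE ?invr_gt0 ?expR_gt0// -expRN.
have -> : (1 : R) = 2^-1 + 2^-1 by field.
rewrite expRD; have := expR_gt0 (2^-1 : R); nra.
Qed.

(** * Hyperbolic functions and their Taylor remainders on [-1, 1] *)

Definition cosh x := (expR x + expR (- x)) / 2.
Definition sinh x := (expR x - expR (- x)) / 2.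

Lemma is_derive_sinh x : is_derive x 1 sinh (cosh x).
Proof.
by rewrite /sinh /cosh; apply: is_derive_eq; rewrite /GRing.scale /=; field.
Qed.

Lemma is_derive_cosh x : is_derive x 1 cosh (sinh x).
Proof.
by rewrite /sinh /cosh; apply: is_derive_eq; rewrite /GRing.scale /=; field.
Qed.

Lemma cosh_ge1 x : 1 <= cosh x.
Proof.
by rewrite /cosh; have := expR_ge1Dx x; have := expR_ge1Dx (- x); lra.
Qed.

Lemma cosh_le4 x : `|x| <= 1 -> cosh x <= 4.
Proof.
rewrite ler_norml => /andP[x1 x2].
have h y : y <= 1 -> expR y <= 4.
  by move=> y1; apply: le_trans expR1_le4; rewrite ler_expR.
rewrite /cosh; have := h _ x2; have := h (- x); lra.
Qed.

Lemma norm_cosh_le x : `|x| <= 1 -> `|cosh x| <= 4.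
Proof.
move=> x1; rewrite ger0_norm ?cosh_le4//.
exact: le_trans (cosh_ge1 x).
Qed.

Lemma norm_sinh_le x : `|x| <= 1 -> `|sinh x| <= 4 * `|x|.
Proof.
move=> x1; rewrite -[X in 4 * X]expr1; apply: (@is_derive_norm_le sinh cosh 4 1 0) => //.
- by rewrite /sinh oppr0 subrr mul0r.
- exact: is_derive_sinh.
- by move=> s s1; rewrite expr0 mulr1 norm_cosh_le.
Qed.

Lemma cosh_sub1_le x : `|x| <= 1 -> `|cosh x - 1| <= 4 * `|x| ^+ 2.
Proof.
move=> x1; apply: (@is_derive_norm_le (fun x => cosh x - 1) sinh 4 1 1) => //.
- by rewrite /cosh oppr0 expR0; field.
- move=> z; have ? := is_derive_cosh z.
  by apply: is_derive_eq; rewrite /GRing.scale /=; ring.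
- by move=> s s1; rewrite expr1 norm_sinh_le.
Qed.

Lemma sinh_subid_le x : `|x| <= 1 -> `|sinh x - x| <= 4 * `|x| ^+ 3.
Proof.
move=> x1; apply: (@is_derive_norm_le (fun x => sinh x - x) (fun x => cosh x - 1) 4 1 2) => //.
- by rewrite /sinh oppr0 subrr mul0r addr0.
- move=> z; have ? := is_derive_sinh z.
  by apply: is_derive_eq; rewrite /GRing.scale /=; ring.
- by move=> s s1; rewrite cosh_sub1_le.
Qed.

Lemma cosh_sub_taylor2_le x : `|x| <= 1 ->
  `|cosh x - (1 + x ^+ 2 / 2)| <= 4 * `|x| ^+ 4.
Proof.
move=> x1; apply: (@is_derive_norm_le (fun x => cosh x - (1 + x ^+ 2 / 2))
  (fun x => sinh x - x) 4 1 3) => //.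
- by rewrite /cosh oppr0 expR0 expr0n/=; field.
- move=> z; have ? := is_derive_cosh z.
  by apply: is_derive_eq; rewrite /GRing.scale /= ?expr1; field.
- by move=> s s1; rewrite sinh_subid_le.
Qed.

Lemma expR_lipschitz_le a b (m : R) : a <= m -> b <= m ->
  `|expR a - expR b| <= expR m * `|a - b|.
Proof.
wlog ba : a b / b <= a => [hw|] am bm.
  have [/hw|/ltW ab] := leP b a; first exact.
  by rewrite distrC (distrC a); apply: hw.
rewrite !ger0_norm ?subr_ge0 ?ler_expR//.
have h : 1 + (b - a) <= expR (b - a) := expR_ge1Dx _.
have -> : expR a - expR b = expR a * (1 - expR (b - a)).
  by rewrite mulrBr mulr1 -expRD subrKC.
apply: (@le_trans _ _ (expR a * (a - b))).
  by rewrite ler_wpM2l ?expR_ge0//; lra.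
by rewrite ler_wpM2r ?subr_ge0// ler_expR.
Qed.

(** Both tilted integrands, lattice and Gaussian, have the form e^a cos alpha. The common majorant
    e^m keeps their decay while exponents and phases are compared additively. *)
Lemma expR_cos_dist a b alpha beta (m : R) : a <= m -> b <= m ->
  `|expR a * cos alpha - expR b * cos beta| <=
    expR m * (`|a - b| + `|alpha - beta|).
Proof.
move=> am bm.
have -> : expR a * cos alpha - expR b * cos beta =
  (expR a - expR b) * cos alpha + expR b * (cos alpha - cos beta) by ring.
rewrite [leRHS]mulrDr; apply: (le_trans (ler_normD _ _)); apply: lerD; rewrite normrM.
  apply: le_trans (expR_lipschitz_le am bm).
  by rewrite ler_piMr// cos_max.
rewrite (ger0_norm (expR_ge0 _)).
by apply: ler_pM; rewrite ?expR_ge0 ?ler_expR ?cos_lipschitz.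
Qed.

(* [e^(y/k) >= y/k] raised to the power [k]. *)
Lemma expr_le_expR y k : 0 <= y -> y ^+ k.+1 <= k.+1%:R ^+ k.+1 * expR y.
Proof.
move=> y0.
have h : y / k.+1%:R <= expR (y / k.+1%:R).
  by apply: le_trans (expR_ge1Dx _); rewrite lerDr.
have : (y / k.+1%:R) ^+ k.+1 <= expR (y / k.+1%:R) ^+ k.+1.
  by rewrite lerXn2r ?nnegrE ?expR_ge0// divr_ge0.
rewrite -expRM_natr divfK ?pnatr_eq0// expr_div_n ler_pdivrMr ?exprn_gt0//.
by rewrite mulrC.
Qed.

End elementary.

(** * Integration on the line and the half-line *)

Section integration.
Variable R : realType.
Notation mu := (@lebesgue_measure R).
Implicit Types (f F G : R -> R) (a b c p q t x y z : R).

Lemma is_derive_continuous f (df x : R) : is_derive x 1 f df -> {for x, continuous f}.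
Proof.
by move=> h; apply/differentiable_continuous/derivable1_diffP; apply: ex_derive.
Qed.

Lemma continuous_integrable_itv f a b : continuous f ->
  mu.-integrable `[a, b] (EFin \o f).
Proof.
move=> cf; apply: continuous_compact_integrable; first exact: segment_compact.
exact: continuous_subspaceT.
Qed.

Lemma integral_itv_FTC f F a b : a < b ->
  (forall x, a <= x <= b -> {for x, continuous f}) ->
  (forall x, a <= x <= b -> is_derive x 1 F (f x)) ->
  (\int[mu]_(x in `[a, b]) (f x)%:E = (F b - F a)%:E)%E.
Proof.
move=> ab cf dF.
have cF x : a <= x <= b -> {for x, continuous F}.
  by move=> /dF; exact: is_derive_continuous.
rewrite (@continuous_FTC2 _ f F a b)//.
- apply: continuous_in_subspaceT => x; rewrite inE/= in_itv/=; exact: cf.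
- split.
  + move=> x; rewrite in_itv/= => /andP[ax xb].
    by have [] := dF x; rewrite ?(ltW ax) ?(ltW xb).
  + by apply: cvg_at_right_filter; apply: cF; rewrite lexx (ltW ab).
  + by apply: cvg_at_left_filter; apply: cF; rewrite lexx (ltW ab).
- move=> x; rewrite in_itv/= => /andP[ax xb].
  have h : is_derive x 1 F (f x) by apply: dF; rewrite !ltW.
  by rewrite derive1E derive_val.
Qed.

Lemma Rintegral_itv_FTC f F a b : a < b -> continuous f ->
  (forall x, is_derive x 1 F (f x)) ->
  \int[mu]_(x in `[a, b]) f x = F b - F a.
Proof.
move=> ab cf dF.
by rewrite /Rintegral (integral_itv_FTC ab (fun x _ => cf x) (fun x _ => dF x)).
Qed.

Lemma is_derive_Rintegral (f df : R -> R -> R) a b x0 :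
  (forall x y, is_derive x 1 (f ^~ y) (df x y)) ->
  (forall x, continuous (f x)) ->
  (exists2 M, 0 <= M & forall x y, `|x - x0| < 1 -> a <= y <= b -> `|df x y| <= M) ->
  is_derive x0 1 (fun x => \int[mu]_(y in `[a, b]) f x y)
                 (\int[mu]_(y in `[a, b]) df x0 y).
Proof.
move=> Hd cf [M M0 HM].
have I0 : `]x0 - 1, x0 + 1[%classic x0 by rewrite /= in_itv/=; apply/andP; split; lra.
have mI : measurable (`[a, b]%classic : set (measurableTypeR R)) by exact: measurable_itv.
have pd x y : partial1of2 f x y = df x y.
  by have h := Hd x y; rewrite /partial1of2 derive1E derive_val.
have iM : mu.-integrable `[a, b] (EFin \o (fun=> M)).
  by apply: continuous_integrable_itv => z; exact: cvg_cst.
have int x : mu.-integrable `[a, b] (EFin \o f x).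
  exact: continuous_integrable_itv.
have der x y : derivable (f ^~ y) x 1 by have [] := Hd x y.
have ub x y : `]x0 - 1, x0 + 1[%classic x -> `[a, b]%classic y ->
    `|partial1of2 f x y| <= M.
  rewrite /= !in_itv/= => /andP[h1 h2] yab; rewrite pd; apply: HM => //.
  by rewrite ltr_norml; apply/andP; split; lra.
have e : \int[mu]_(y in `[a, b]) df x0 y = \int[mu]_(y in `[a, b]) partial1of2 f x0 y.
  by apply: eq_Rintegral => y _; rewrite pd.
have cv := @cvg_differentiation_under_integral R _ _ mu f `[a, b]%classic mI x0 _ _ I0
  (fun x _ => int x) (fun x y _ _ => der x y) (fun=> M) (fun=> M0) iM ub.
split.
  apply/cvg_ex; eexists; under eq_fun do rewrite scaler1.
  exact: cv.
rewrite e -derive1E /derive1; apply/cvg_lim => //.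
Qed.

(** The shape is adapted to the substitution x -> c / x, which maps [exhaust 1 n] onto
    [exhaust c n]. Starting at n + 2 keeps the two end points distinct when c > 0. *)
Definition exhaust c (n : nat) : set R := `[c / n.+2%:R, c * n.+2%:R]%classic.

Lemma exhaust_bigcup c : 0 < c -> \bigcup_n exhaust c n = `]0, +oo[%classic.
Proof.
move=> c0; apply/seteqP; split=> x /=.
  move=> [n _]; rewrite /exhaust/= !in_itv/= andbT => /andP[h _].
  by apply: lt_le_trans h; rewrite divr_gt0.
rewrite in_itv/= andbT => x0.
have h0 : 0 <= x / c + c / x by rewrite addr_ge0// divr_ge0// ltW.
have := archi_boundP h0; set n := Num.bound _ => hn.
have n2 : (n%:R : R) <= n.+2%:R by rewrite ler_nat; lia.
have p1 : 0 < x / c by rewrite divr_gt0.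
have p2 : 0 < c / x by rewrite divr_gt0.
exists n => //; rewrite /exhaust/= in_itv/=; apply/andP; split.
  rewrite ler_pdivrMr// mulrC -ler_pdivrMr//; lra.
rewrite mulrC -ler_pdivrMr//; lra.
Qed.

Lemma ge0_integral_exhaust_cvg c f : 0 < c ->
  {in `]0, +oo[%classic, continuous f} -> (forall x, 0 < x -> 0 <= f x) ->
  (\int[mu]_(x in exhaust c n) (f x)%:E)%E @[n --> \oo] -->
  (\int[mu]_(x in `]0%R, +oo[) (f x)%:E)%E.
Proof.
move=> c0 cf f0; rewrite -(exhaust_bigcup c0).
have sub n : exhaust c n `<=` `]0, +oo[%classic.
  by rewrite -(exhaust_bigcup c0); exact: bigcup_sup.
have mE n : measurable (exhaust c n : set (measurableTypeR R)) by exact: measurable_itv.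
apply: ge0_nondecreasing_set_cvg_integral => //.
- move=> n m nm; apply/subsetPset => x; rewrite /exhaust/= !in_itv/= => /andP[h1 h2].
  have nm2 : (n.+2%:R : R) <= m.+2%:R by rewrite ler_nat; lia.
  apply/andP; split.
    by apply: le_trans h1; rewrite ler_pM2l// lef_pV2// posrE.
  by apply: le_trans h2 _; rewrite ler_pM2l.
- move=> n; apply/measurable_EFinP; apply: measurable_funS (sub n) _ => //.
  by apply: open_continuous_measurable_fun => //; exact: interval_open.
- by move=> n x /sub; rewrite /= in_itv/= andbT lee_fin; exact: f0.
Qed.

(** On each exhausting interval the integral is a difference of two values of F, hence at most B. A
    bounded antiderivative suffices; its limits at 0 and at infinity need not be identified. *)
Lemma integral0y_le f F B : {in `]0, +oo[%classic, continuous f} ->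
  (forall x, 0 < x -> 0 <= f x) ->
  (forall x, 0 < x -> is_derive x 1 F (f x)) ->
  (forall x, 0 < x -> - B <= F x <= 0) ->
  (\int[mu]_(x in `]0%R, +oo[) (f x)%:E <= B%:E)%E.
Proof.
move=> cf f0 dF bF.
have cv := ge0_integral_exhaust_cvg (@ltr01 R) cf f0.
rewrite -(cvg_lim _ cv)//; apply: lime_le; first by apply/cvg_ex; eexists; exact: cv.
apply: nearW => n; rewrite /exhaust.
have n2 : 1 < n.+2%:R :> R by rewrite ltr1n.
have i0 : 0 < 1 / n.+2%:R :> R by rewrite divr_gt0.
have ab : 1 / n.+2%:R < 1 * n.+2%:R :> R.
  by rewrite !mul1r; apply: (@lt_trans _ _ 1) => //; rewrite invf_lt1.
have cfn x : 1 / n.+2%:R <= x <= 1 * n.+2%:R -> {for x, continuous f}.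
  by move=> /andP[h _]; apply: cf; rewrite inE/= in_itv/= andbT (lt_le_trans i0).
have dFn x : 1 / n.+2%:R <= x <= 1 * n.+2%:R -> is_derive x 1 F (f x).
  by move=> /andP[h _]; apply: dF; rewrite (lt_le_trans i0).
rewrite (integral_itv_FTC ab cfn dFn) lee_fin; have /andP[h1 _] := bF _ i0.
by have /andP[_ h2] := bF _ (lt_trans i0 ab); lra.
Qed.

Lemma integral0y_inv_subst c G : 0 < c ->
  {in `]0, +oo[%classic, continuous G} -> (forall x, 0 < x -> 0 <= G x) ->
  (\int[mu]_(x in `]0%R, +oo[) (G x)%:E =
   \int[mu]_(x in `]0%R, +oo[) (G (c / x) * (c / x ^+ 2))%:E)%E.
Proof.
move=> c0 cG G0.
pose F x := c / x.
have dF x : 0 < x -> is_derive x 1 F (- (c / x ^+ 2)).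
  move=> x0; have xn0 := lt0r_neq0 x0.
  have hh : is_derive x 1 (fun y : R => y^-1) (- x ^- 2 *: 1).
    exact: is_deriveV.
  rewrite /F; apply: is_derive_eq; rewrite /GRing.scale /=.
  by field; rewrite lt0r_neq0.
have cF x : 0 < x -> {for x, continuous F}.
  by move=> /dF; exact: is_derive_continuous.
have dF1 x : 0 < x -> derive1 F x = - (c / x ^+ 2).
  by move=> /dF h; rewrite derive1E derive_val.
have c2 x : 0 < x -> {for x, continuous (fun y => c / y ^+ 2)}.
  move=> x0; apply: cvgM; first exact: cvg_cst.
  apply: cvgV; first by rewrite expf_neq0// lt0r_neq0.
  exact: exprn_continuous.
have cdF x : 0 < x -> derive1 F y @[y --> x] --> - (c / x ^+ 2).
  move=> x0.
  have h : (- (c / y ^+ 2)) @[y --> x] --> - (c / x ^+ 2).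
    by apply: cvgN; exact: (c2 x x0).
  apply: cvg_trans h.
  apply: near_eq_cvg; near=> y; rewrite /= dF1//.
  by near: y; exact: lt_nbhsr.
have cv := ge0_integral_exhaust_cvg c0 cG G0.
have cH : {in `]0, +oo[%classic, continuous (fun x => G (c / x) * (c / x ^+ 2))}.
  move=> x; rewrite inE/= in_itv/= andbT => x0; apply: cvgM; last exact: c2.
  apply: (@continuous_comp _ _ _ F G); first exact: cF.
  by apply: cG; rewrite inE/= in_itv/= andbT divr_gt0.
have H0 x : 0 < x -> 0 <= G (c / x) * (c / x ^+ 2).
  by move=> x0; rewrite mulr_ge0 ?G0 ?divr_gt0// divr_ge0 ?(ltW c0)// sqr_ge0.
have cv2 := ge0_integral_exhaust_cvg (@ltr01 R) cH H0.
rewrite -(cvg_lim _ cv)// -(cvg_lim _ cv2)//; congr (lim (_ @ \oo)).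
apply/funext => n; rewrite /exhaust.
have n2 : 1 < n.+2%:R :> R by rewrite ltr1n.
set a := 1 / n.+2%:R; set b := 1 * n.+2%:R.
have a0 : 0 < a by rewrite divr_gt0.
have b0 : 0 < b by rewrite mulr_gt0.
have ab : a < b by rewrite /a /b !mul1r; apply: (@lt_trans _ _ 1) => //; rewrite invf_lt1.
have -> : c / n.+2%:R = F b by rewrite /F /b mul1r.
have -> : c * n.+2%:R = F a by rewrite /F /a div1r invrK.
rewrite (@integration_by_substitution_decreasing _ F G a b (ltW ab)).
- apply: eq_integral => x; rewrite inE/= in_itv/= => /andP[ax _].
  by rewrite !fctE/= dF1 ?opprK// (lt_le_trans a0).
- move=> x y; rewrite !in_itv/= => /andP[ax _] /andP[ay _] yx.
  have y0 := lt_le_trans a0 ay.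
  by rewrite /F ltr_pM2l// ltf_pV2// posrE// (lt_trans y0).
- move=> x; rewrite in_itv/= => /andP[ax _]; have x0 := lt_trans a0 ax.
  by rewrite /continuous_at dF1//; exact: cdF.
- by apply/cvg_ex; eexists; apply: cvg_at_right_filter; exact: cdF.
- by apply/cvg_ex; eexists; apply: cvg_at_left_filter; exact: cdF.
- split.
  + by move=> x; rewrite in_itv/= => /andP[ax _]; have [] := dF x (lt_trans a0 ax).
  + by apply: cvg_at_right_filter; exact: cF.
  + by apply: cvg_at_left_filter; exact: cF.
- apply: continuous_in_subspaceT => x; rewrite inE/= in_itv/= => /andP[h _].
  by apply: cG; rewrite inE/= in_itv/= andbT; apply: lt_le_trans h; rewrite divr_gt0.
Unshelve. all: by end_near. Qed.

Lemma integral0y_cauchy_le a : 0 < a ->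
  (\int[mu]_(x in `]0%R, +oo[) (a / (a + x) ^+ 2)%:E <= 1)%E.
Proof.
move=> a0.
have h x : 0 < x -> a + x != 0 by move=> x0; rewrite lt0r_neq0// addr_gt0.
apply: (@integral0y_le _ (fun x => - (a / (a + x)))).
- move=> x; rewrite inE/= in_itv/= andbT => x0.
  apply: cvgM; first exact: cvg_cst.
  apply: cvgV; first by rewrite expf_neq0// h.
  apply: (@continuous_comp _ _ _ (fun x => a + x) (fun x => x ^+ 2)).
    by apply: cvgD; [exact: cvg_cst|exact: cvg_id].
  exact: exprn_continuous.
- by move=> x x0; rewrite divr_ge0 ?sqr_ge0// ltW.
- move=> x x0; have e := h _ x0.
  have hh : is_derive x 1 (fun y : R => (a + y)^-1) (- (a + x) ^- 2 *: (0 + 1)).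
    exact: is_deriveV.
  apply: is_derive_eq; rewrite /GRing.scale /=; field.
  by rewrite e.
- move=> x x0; have h1 : 0 <= a / (a + x) by rewrite divr_ge0 ?addr_ge0// ltW.
  have h2 : a / (a + x) <= 1 by rewrite ler_pdivrMr ?addr_gt0// mul1r lerDl ltW.
  by apply/andP; split; lra.
Qed.

(* Comparable to x^(p-1) near 0 and to x^(-p-1) near infinity. *)
Definition powdom (p x : R) := x `^ (p - 1) / (1 + x `^ p) ^+ 2.

Lemma powdom_ge0 p x : 0 <= powdom p x.
Proof. by rewrite divr_ge0 ?powR_ge0// sqr_ge0. Qed.

Lemma powR_continuous_pos p x : 0 < x -> {for x, continuous (fun y : R => y `^ p)}.
Proof.
by move=> x0; apply: is_derive_continuous; exact: is_derive1_powR.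
Qed.

Lemma powdom_continuous p : {in `]0, +oo[%classic, continuous (powdom p)}.
Proof.
move=> x; rewrite inE/= in_itv/= andbT => x0.
apply: cvgM; first exact: powR_continuous_pos.
apply: cvgV; first by rewrite expf_neq0// lt0r_neq0// addr_gt0// powR_gt0.
apply: (@continuous_comp _ _ _ (fun x => 1 + x `^ p) (fun x => x ^+ 2)).
  by apply: cvgD; [exact: cvg_cst|exact: powR_continuous_pos].
exact: exprn_continuous.
Qed.

(** The dominating function is the derivative of - 1 / (p (1 + x^p)), which stays between - 1 / p
    and 0; this explicit primitive is the reason for its form. *)
Lemma powdom_integrable p : 0 < p ->
  mu.-integrable `]0, +oo[ (EFin \o powdom p).
Proof.
move=> p0; apply/integrableP; split.
  apply/measurable_EFinP; apply: open_continuous_measurable_fun => //.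
  exact: powdom_continuous.
apply: (@le_lt_trans _ _ (\int[mu]_(x in `]0%R, +oo[) (powdom p x)%:E)%E).
  rewrite le_eqVlt; apply/orP; left; apply/eqP; apply: eq_integral => x _ /=.
  by rewrite ger0_norm// powdom_ge0.
apply: (@le_lt_trans _ _ (p^-1)%:E); last by rewrite ltry.
apply: (@integral0y_le _ (fun x => - (p^-1 / (1 + x `^ p)))).
- exact: powdom_continuous.
- by move=> *; exact: powdom_ge0.
- move=> x x0; have hp := is_derive1_powR p x0.
  have e : 1 + x `^ p != 0 by rewrite lt0r_neq0// addr_gt0// powR_gt0.
  have hh : is_derive x 1 (fun y : R => (1 + y `^ p)^-1)
      (- (1 + x `^ p) ^- 2 *: (0 + p * x `^ (p - 1))).
    exact: is_deriveV.
  rewrite /powdom; apply: is_derive_eq; rewrite /GRing.scale /=.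
  field; rewrite e lt0r_neq0//.
- move=> x x0; have e := powR_gt0 p x0.
  have h1 : 0 <= p^-1 / (1 + x `^ p) by rewrite divr_ge0 ?invr_ge0 ?addr_ge0// ltW.
  have h2 : p^-1 / (1 + x `^ p) <= p^-1.
    by rewrite ler_pdivrMr ?addr_gt0// ler_peMr ?invr_ge0 ?(ltW p0)// lerDl ltW.
  by apply/andP; split; lra.
Qed.

(** The 4 here is (1 + x^p)^2 <= 4 for x <= 1; its counterpart for x >= 1 uses (1 + x^p)^2 <= 4 x^(2
    p). *)
Lemma powR_le_powdom_lt1 p q x : 0 < x <= 1 -> p - 1 <= q -> 0 < p ->
  x `^ q <= 4 * powdom p x.
Proof.
move=> /andP[x0 x1] pq p0.
have h : x `^ q <= x `^ (p - 1) by apply: ger_powR => //; rewrite x0.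
have h2 : x `^ p <= 1.
  by rewrite -(powRr0 x); apply: ger_powR; rewrite ?x0// ltW.
have hp := powR_gt0 p x0.
apply: le_trans h _; rewrite /powdom mulrCA ler_peMr ?powR_ge0//.
rewrite ler_pdivlMr ?exprn_gt0 ?addr_gt0// mul1r; nra.
Qed.

Lemma powR_le_powdom_ge1 p q x : 1 <= x -> q <= - p - 1 -> 0 < p ->
  x `^ q <= 4 * powdom p x.
Proof.
move=> x1 pq p0; have x0 : 0 < x by exact: lt_le_trans x1.
have h : x `^ q <= x `^ (- p - 1) by exact: ler_powR.
have h2 : 1 <= x `^ p.
  by rewrite -(powRr0 x); apply: ler_powR => //; exact: ltW.
apply: le_trans h _; rewrite /powdom.
have hp := powR_gt0 p x0.
have -> : x `^ (- p - 1) = x `^ (p - 1) * (x `^ (- p) * x `^ (- p)).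
  by rewrite -!powRD ?lt0r_neq0 ?implybT//; congr powR; ring.
rewrite !powRN (mulrC 4) -!mulrA ler_wpM2l ?powR_ge0//.
rewrite -invfM -expr2 (mulrC _ 4) ler_pdivlMr ?exprn_gt0 ?addr_gt0// mulrC.
by rewrite ler_pdivrMr ?exprn_gt0//; nra.
Qed.

Lemma integrable_powdom_le p C f : 0 < p ->
  {in `]0, +oo[%classic, continuous f} ->
  (forall x, 0 < x -> `|f x| <= C * powdom p x) ->
  mu.-integrable `]0, +oo[ (EFin \o f).
Proof.
move=> p0 cf hf.
apply: (@le_integrable _ _ R mu _ _ (EFin \o f) (EFin \o (fun x => C * powdom p x))) => //.
- by apply/measurable_EFinP; exact: open_continuous_measurable_fun.
- move=> x /=; rewrite in_itv/= andbT => x0; rewrite lee_fin.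
  by apply: le_trans (hf _ x0) _; rewrite ler_norm.
- exact: (@integrableZl _ _ R mu _ _ C _ (powdom_integrable p0)).
Qed.

Lemma Rintegral_cauchy_le t a : 0 < t -> 0 < a ->
  \int[mu]_(x in `[- a, a]) (1 + t * x ^+ 2)^-1 <= pi / Num.sqrt t.
Proof.
move=> t0 a0; set s := Num.sqrt t.
have s0 : 0 < s by rewrite sqrtr_gt0.
have ts : t = s ^+ 2 by rewrite sqr_sqrtr// ltW.
have g0 x : 1 + t * x ^+ 2 != 0.
  by rewrite lt0r_neq0// ltr_pwDl// mulr_ge0 ?sqr_ge0// ltW.
have aa : - a < a by lra.
have cf : continuous (fun x : R => (1 + t * x ^+ 2)^-1).
  move=> x; apply: cvgV => //.
  apply: cvgD; first exact: cvg_cst.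
  by apply: cvgM; [exact: cvg_cst|exact: exprn_continuous].
have dF x : is_derive x 1 (fun y : R => atan (s * y) / s) (1 + t * x ^+ 2)^-1.
  have h1 : is_derive x 1 (fun y : R => s * y) s.
    by apply: is_derive_eq; rewrite /GRing.scale /=; ring.
  have h : is_derive x 1 (fun y : R => atan (s * y)) ((1 + (s * x) ^+ 2)^-1 * s).
    exact: (is_derive1_comp (is_derive1_atan (s * x)) h1).
  apply: is_derive_eq; rewrite /GRing.scale /= ts.
  have e := g0 x; rewrite ts in e.
  by rewrite exprMn mulr0 add0r mulrCA mulVf ?mulr1// lt0r_neq0.
rewrite (Rintegral_itv_FTC aa cf dF) mulrN atanN mulNr opprK -mulrDl.
rewrite ler_wpM2r ?invr_ge0 ?(ltW s0)//.
by have := atan_ltpi2 (s * a); lra.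
Qed.

(** The known integral over the whole line, rescaled by sqrt t. It is phrased as a limit over
    growing intervals because differentiation under the integral and the kernel comparison are
    carried out on compact intervals. *)
Lemma Rintegral_gauss_cvg t : 0 < t ->
  \int[mu]_(x in `[- n.+1%:R, n.+1%:R]) expR (- (t * x ^+ 2)) @[n --> \oo] -->
  Num.sqrt pi / Num.sqrt t.
Proof.
move=> t0; set s := Num.sqrt t.
have s0 : 0 < s by rewrite sqrtr_gt0.
have ts : t = s ^+ 2 by rewrite sqr_sqrtr// ltW.
pose g x : R := expR (- (t * x ^+ 2)).
have dF x : is_derive x 1 (fun y : R => s * y) s.
  by apply: is_derive_eq; rewrite /GRing.scale /=; ring.
have F' : derive1 (fun y : R => s * y) = cst s.
  by apply/funext => x; rewrite derive1E; have h := dF x; rewrite derive_val.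
have cg : continuous g.
  move=> x; apply: (@is_derive_continuous _ (expR (- (t * x ^+ 2)) * - (t * (x *+ 2)))).
  apply: is_derive_eq; rewrite /GRing.scale /=; ring.
have sub : (\int[mu]_x (g x)%:E = (Num.sqrt pi / s)%:E)%E.
  have := @increasing_ge0_integration_by_substitutionT R (fun y => s * y) gauss_fun.
  rewrite F' integralT_gauss => H.
  have {}H : ((Num.sqrt pi)%:E = \int[mu]_x (s%:E * (g x)%:E))%E.
    rewrite H.
    - apply: eq_integral => x _ /=.
      by rewrite !fctE /gauss_fun /g ts exprMn -EFinM mulrC.
    - by move=> x y xy; rewrite ltr_pM2l.
    - by move=> x; exact: cvg_cst.
    - exact: is_cvg_cst.
    - exact: is_cvg_cst.
    - by move=> x; have [] := dF x.
    - by apply: gt0_cvgMrNy => //.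
    - by apply: gt0_cvgMry => //.
    - exact: continuous_gauss_fun.
    - exact: gauss_fun_ge0.
  rewrite ge0_integralZl in H => //.
  - by rewrite EFinM muleC H muleA -EFinM mulVf ?mul1e// lt0r_neq0.
  - by apply/measurable_EFinP; exact: continuous_measurable_fun.
  - by move=> x _; rewrite lee_fin expR_ge0.
  - by rewrite lee_fin ltW.
have bc : \bigcup_n `[- n.+1%:R, n.+1%:R]%classic = [set: R].
  apply/seteqP; split => // x _.
  have := archi_boundP (normr_ge0 x); set n := Num.bound _ => hn.
  exists n => //=; rewrite in_itv/=; rewrite -ler_norml.
  by apply: le_trans (ltW hn) _; rewrite ler_nat.
rewrite -bc in sub; apply: fine_cvg; rewrite -sub.
apply: ge0_nondecreasing_set_cvg_integral => //.
- move=> n m nm; apply/subsetPset => x /=; rewrite !in_itv/= -!ler_norml => h.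
  by apply: le_trans h _; rewrite ler_nat.
by move=> n; apply/measurable_EFinP/measurable_funTS; exact: continuous_measurable_fun.
Qed.

End integration.

(** * Uniqueness for the discrete heat equation *)

Section heat_uniqueness.
Variable R : realType.
Implicit Types (s t : R).

Lemma is_derive_exprS (g : R -> R) (dg s : R) N : is_derive s 1 g dg ->
  is_derive s 1 (fun y => g y ^+ N.+1) (N.+1%:R * g s ^+ N * dg).
Proof.
move=> hg; elim: N => [|N IH]; first by rewrite expr0 !mul1r.
have -> : (fun y => g y ^+ N.+2) = (fun y => g y * g y ^+ N.+1).
  by apply/funext => y; rewrite exprS.
apply: is_derive_eq; rewrite /GRing.scale /= -(natr1 N.+1) exprS; ring.
Qed.

(** The difference of phi and K s^(N+1) / (N+1) is nonincreasing, and likewise for - phi. Here the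
    factor 1 / (N+1) must be kept: accumulated over N it becomes the factorial that drives
    uniqueness. *)
Lemma deriv_growth (phi dphi : R -> R) (K T : R) (N : nat) : 0 <= K -> phi 0 = 0 ->
  (forall t, is_derive t 1 phi (dphi t)) ->
  (forall t, 0 <= t <= T -> `|dphi t| <= K * t ^+ N) ->
  forall t, 0 <= t <= T -> `|phi t| <= K * t ^+ N.+1 / N.+1%:R.
Proof.
move=> K0; have N1 : N.+1%:R != 0 :> R by rewrite pnatr_eq0.
have key (f df : R -> R) : f 0 = 0 ->
    (forall t, is_derive t 1 f (df t)) ->
    (forall t, 0 <= t <= T -> df t <= K * t ^+ N) ->
    forall t, 0 <= t <= T -> f t <= K * t ^+ N.+1 / N.+1%:R.
  move=> f0 df_ dfb t /andP[t0 tT].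
  pose g s := f s - K * s ^+ N.+1 / N.+1%:R.
  have dg s : is_derive s 1 g (df s - K * s ^+ N).
    rewrite /g; have dfs := df_ s.
    have hp := is_derive_exprS N (is_derive_id s 1).
    apply: is_derive_eq; rewrite /GRing.scale /=.
    by rewrite !(mulr0, add0r) mulr1 (mulrCA _ K) mulKf.
  have g0 : g 0 = 0 by rewrite /g f0 exprS mul0r mulr0 mul0r subrr.
  rewrite -subr_le0 -g0; apply: (@ler0_derive1_le_cc R g 0 t) => //.
  - move=> s; rewrite in_itv/= => /andP[s0 st].
    have h := dg s; rewrite derive1E derive_val subr_le0.
    by apply: dfb; rewrite (ltW s0) (le_trans (ltW st)).
  - by apply: continuous_subspaceT => s; apply: is_derive_continuous (dg s).
  - by rewrite in_itv/= t0 lexx.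
  - by rewrite in_itv/= lexx t0.
move=> p0 dp hb t tT; rewrite ler_norml; apply/andP; split; last first.
  apply: (key phi dphi) => // s sT; apply: le_trans (hb _ sT); exact: ler_norm.
rewrite lerNl; apply: (key (fun s => - phi s) (fun s => - dphi s)) => //.
- by rewrite p0 oppr0.
- by move=> s sT; apply: le_trans (hb _ sT); rewrite -normrN ler_norm.
Qed.

(** * Weighted bounds for the Laplacian and partial sums of the heat semigroup *)

Variable d : nat.
Notation pt := 'rV[int]_d.
Implicit Types (x y z : pt) (g h : pt -> R).

Lemma lap_addZ g h (c : R) z :
  lap (fun y => g y + c * h y) z = lap g z + c * lap h z.
Proof.
by rewrite /lap mulr_sumr -big_split; apply: eq_bigr => i _ /=; ring.
Qed.

(** A weight that changes by at most a factor q per lattice step makes [lap] a bounded operator for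
    the W-weighted supremum norm, even when W grows exponentially. *)
Lemma norm_lap_le (W : pt -> R) (q A : R) h z :
  (forall z i, W (z + unitv i) <= q * W z) ->
  (forall z i, W (z - unitv i) <= q * W z) -> 0 <= A ->
  (forall z, `|h z| <= A * W z) ->
  `|lap h z| <= (2 * (1 + q) * d%:R) * A * W z.
Proof.
move=> Wp Wm A0 hW; rewrite /lap.
apply: (le_trans (ler_norm_sum _ _ _)).
apply: (@le_trans _ _ (\sum_(i < d) (2 * (1 + q) * A * W z))).
  apply: ler_sum => i _.
  have h1 := hW z; have h2 := hW (z + unitv i); have h3 := hW (z - unitv i).
  have h4 := ler_wpM2l A0 (Wp z i); have h5 := ler_wpM2l A0 (Wm z i).
  apply: (le_trans (ler_normD _ _)).
  have h6 := ler_normB (h z) (h (z + unitv i)).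
  have h7 := ler_normB (h z) (h (z - unitv i)).
  lra.
rewrite sumr_const card_ord -mulr_natr le_eqVlt; apply/orP; left; apply/eqP; ring.
Qed.

Definition heat_psum (N : nat) t z : R :=
  \sum_(0 <= n < N) ((- t) ^+ n / (n`!)%:R * iter n (@lap R d) (@ind0 R d) z).

Lemma heat_psumS N t z : heat_psum N.+1 t z =
  heat_psum N t z + (- t) ^+ N / (N`!)%:R * iter N (@lap R d) (@ind0 R d) z.
Proof. by rewrite /heat_psum big_nat_recr. Qed.

Lemma is_derive_heat_psum N t z :
  is_derive t 1 (fun s => heat_psum N.+1 s z) (- lap (heat_psum N t) z).
Proof.
elim: N => [|N IH].
  have -> : (fun s => heat_psum 1 s z) = cst (@ind0 R d z).
    apply/funext => s; rewrite /heat_psum big_nat1 /=.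
    by rewrite expr0 fact0 divr1 mul1r.
  have -> : lap (heat_psum 0 t) z = 0.
    by rewrite /lap big1// => i _; rewrite /heat_psum !big_nil !subrr addr0.
  by rewrite oppr0; exact: is_derive_cst.
have -> : (fun s => heat_psum N.+2 s z) = (fun s => heat_psum N.+1 s z +
   (- s) ^+ N.+1 / (N.+1`!)%:R * iter N.+1 (@lap R d) (@ind0 R d) z).
  by apply/funext => s; rewrite heat_psumS.
have e : lap (heat_psum N.+1 t) z = lap (heat_psum N t) z +
    (- t) ^+ N / (N`!)%:R * iter N.+1 (@lap R d) (@ind0 R d) z.
  rewrite -lap_addZ; congr (lap _ z); apply/funext => y; exact: heat_psumS.
rewrite e opprD.
have hp : is_derive t 1 (fun s : R => (- s) ^+ N.+1) (- (N.+1%:R * (- t) ^+ N)).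
  have hn : is_derive t 1 (fun s : R => - s) (-1).
    by apply: is_derive_eq.
  by have := is_derive_exprS N hn; rewrite mulrN1.
move: (iter _ _ _ z) => k.
apply: is_derive_eq; rewrite /GRing.scale /=.
have f0 : (N`!)%:R != 0 :> R by rewrite pnatr_eq0 -lt0n fact_gt0.
have n0 : N.+1%:R != 0 :> R by rewrite pnatr_eq0.
rewrite !(mulr0, add0r) !mulrN; congr (_ - _); rewrite mulrC; congr (_ * _).
by rewrite factS natrM invfM mulrC mulrACA divff// mul1r.
Qed.

(* The Taylor remainders of [f] at time 0 satisfy [E_{N+1}' = - lap E_N], so they
   decay factorially; the weight [W] allows solutions growing exponentially. *)
Lemma heat_unique (f : R -> pt -> R) (W : pt -> R) (q A T : R) :
  (forall z, 0 <= W z) -> 0 <= q -> 0 <= A ->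
  (forall z i, W (z + unitv i) <= q * W z) ->
  (forall z i, W (z - unitv i) <= q * W z) ->
  (forall t z, is_derive t 1 (f ^~ z) (- lap (f t) z)) ->
  (forall z, f 0 z = @ind0 R d z) ->
  (forall t z, 0 <= t <= T -> `|f t z| <= A * W z) ->
  0 <= T -> forall z, heat T z = f T z.
Proof.
move=> W0 q0 A0 Wp Wm df f0 fW T0 z.
set B := 2 * (1 + q) * d%:R.
have B0 : 0 <= B by rewrite !mulr_ge0 ?addr_ge0.
have key N : forall t z, 0 <= t <= T ->
    `|f t z - heat_psum N t z| <= A * W z * B ^+ N * t ^+ N / (N`!)%:R.
  elim: N => [|N IH] t y tT.
    by rewrite /heat_psum big_nil subr0 !expr0 fact0 divr1 !mulr1 fW.
  have -> : A * W y * B ^+ N.+1 * t ^+ N.+1 / (N.+1`!)%:R =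
     (A * W y * B ^+ N.+1 / (N`!)%:R) * t ^+ N.+1 / N.+1%:R.
    rewrite factS natrM invfM; ring.
  apply: (@deriv_growth (fun s => f s y - heat_psum N.+1 s y)
    (fun s => - lap (f s) y - (- lap (heat_psum N s) y)) _ T N) => //.
  - by rewrite !mulr_ge0 ?exprn_ge0 ?invr_ge0.
  - rewrite f0 /heat_psum big_nat_recl//= big1 => [|i _].
      by rewrite expr0 fact0 divr1 mul1r addr0 subrr.
    by rewrite oppr0 exprS !mul0r.
  - by move=> s; have h := df s y; have h2 := is_derive_heat_psum N s y; exact: is_deriveB.
  move=> s sT.
  have -> : - lap (f s) y - - lap (heat_psum N s) y =
      - lap (fun x => f s x + (-1) * heat_psum N s x) y.
    by rewrite lap_addZ; ring.
  rewrite normrN.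
  have := @norm_lap_le W q (A * B ^+ N * s ^+ N / (N`!)%:R)
    (fun x => f s x + -1 * heat_psum N s x) y Wp Wm.
  have [s0 _] := andP sT.
  have -> : 0 <= A * B ^+ N * s ^+ N / (N`!)%:R.
    by rewrite !mulr_ge0 ?exprn_ge0 ?invr_ge0.
  move=> /(_ isT) hh; apply: le_trans (hh _) _.
    move=> x; rewrite mulN1r; apply: le_trans (IH s x sT) _.
    by rewrite le_eqVlt; apply/orP; left; apply/eqP; ring.
  rewrite -/B exprS.
  by rewrite le_eqVlt; apply/orP; left; apply/eqP; ring.
rewrite /heat; apply/cvg_lim => //.
change (heat_psum n T z @[n --> \oo] --> f T z).
(* The remainder bound is, up to a constant, the general term of the convergent exponential series
   at B T. *)
have c0 : A * W z * (B * T) ^+ n / (n`!)%:R @[n --> \oo] --> (0 : R).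
  have := cvg_series_cvg_0 (is_cvg_series_exp_coeff (B * T)).
  move=> h; rewrite -(mulr0 (A * W z)).
  under eq_cvg do rewrite -mulrA.
  by apply: cvgM; [exact: cvg_cst|exact: h].
apply/cvgrPdist_le => e e0.
have /cvgrPdist_le/(_ e e0) := c0; apply: filterS => n; rewrite sub0r normrN => hn.
apply: le_trans hn; apply: le_trans (key n T z _) _.
  by rewrite T0 lexx.
have -> : A * W z * B ^+ n * T ^+ n / n`!%:R = A * W z * (B * T) ^+ n / n`!%:R.
  by rewrite [(B * T) ^+ n]exprMn !mulrA.
exact: ler_norm.
Qed.

Lemma is_derive_prod n (f : 'I_n -> R -> R) (df : 'I_n -> R) t :
  (forall i, is_derive t 1 (f i) (df i)) ->
  is_derive t 1 (fun s => \prod_(i < n) f i s)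
    (\sum_(i < n) \prod_(j < n) (if j == i then df j else f j t)).
Proof.
elim: n f df => [|n IH] f df h.
  have -> : (fun s => \prod_(i < 0) f i s) = cst 1.
    by apply/funext => s; rewrite big_ord0.
  by rewrite big_ord0; exact: is_derive_cst.
have -> : (fun s => \prod_(i < n.+1) f i s) =
   (fun s => f ord0 s * \prod_(i < n) f (lift ord0 i) s).
  by apply/funext => s; rewrite big_ord_recl.
have h0 := h ord0; have hn := IH _ _ (fun i => h (lift ord0 i)).
apply: is_derive_eq; rewrite /GRing.scale /=.
rewrite big_ord_recl addrC; congr (_ + _).
  rewrite big_ord_recl eqxx mulrC; congr (_ * _).
rewrite mulr_sumr; apply: eq_bigr => i _; rewrite big_ord_recl /=.
by congr (_ * _); apply: eq_bigr => j _; rewrite (inj_eq lift_inj).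
Qed.

End heat_uniqueness.

(** * Tilted Fourier representation of the heat kernel *)

Section tilted_fourier.
Variable R : realType.
Notation mu := (@lebesgue_measure R).
Implicit Types (lam t k x y : R) (n : int) (f g : R -> R).

Lemma Rintegral_itvD f g a b : continuous f -> continuous g ->
  \int[mu]_(x in `[a, b]) (f x + g x) =
  \int[mu]_(x in `[a, b]) f x + \int[mu]_(x in `[a, b]) g x.
Proof.
by move=> cf cg; rewrite RintegralD//; exact: continuous_integrable_itv.
Qed.

Lemma Rintegral_itvZ (c : R) f a b : continuous f ->
  \int[mu]_(x in `[a, b]) (c * f x) = c * \int[mu]_(x in `[a, b]) f x.
Proof.
by move=> cf; rewrite RintegralZl//; exact: continuous_integrable_itv.
Qed.

Lemma norm_Rintegral_itv_le f g a b : continuous f -> continuous g ->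
  (forall x, a <= x <= b -> `|f x| <= g x) ->
  `|\int[mu]_(x in `[a, b]) f x| <= \int[mu]_(x in `[a, b]) g x.
Proof.
move=> cf cg fg.
have mI : measurable (`[a, b]%classic : set (measurableTypeR R)) by exact: measurable_itv.
apply: le_trans (le_normr_Rintegral mI (continuous_integrable_itv a b cf)) _.
have cnf : continuous (fun x => `|f x|).
  by move=> x; apply: continuous_comp; [exact: cf|exact: norm_continuous].
apply: (le_Rintegral mI (continuous_integrable_itv a b cnf)
  (continuous_integrable_itv a b cg)).
by move=> x /=; rewrite in_itv/=; exact: fg.
Qed.

(* The real part of [exp (i k z) * exp (- t (2 - 2 cos z))] at [z = x + i lam],
   up to the factor [exp (- lam k)]. *)
Definition tilt lam t k x : R :=
  expR (- (t * (2 - 2 * (cos x * cosh lam)))) *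
  cos (k * x - 2 * t * (sin x * sinh lam)).

Definition dtilt lam t k x : R :=
  expR (- (t * (2 - 2 * (cos x * cosh lam)))) *
  ((2 * (cos x * cosh lam) - 2) * cos (k * x - 2 * t * (sin x * sinh lam)) +
   2 * (sin x * sinh lam) * sin (k * x - 2 * t * (sin x * sinh lam))).

Lemma is_derive_tilt lam t k x :
  is_derive t 1 (fun t => tilt lam t k x) (dtilt lam t k x).
Proof.
rewrite /tilt /dtilt; apply: is_derive_eq; rewrite /GRing.scale /=; ring.
Qed.

Lemma continuous_tilt lam t k : continuous (tilt lam t k).
Proof.
move=> x; rewrite /tilt; apply/differentiable_continuous/derivable1_diffP.
apply: ex_derive.
Qed.

(** Differentiating in t multiplies by 2 cos z - 2 = e^(i z) + e^(- i z) - 2 at z = x + i lam, that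
    is, shifts k by one in both directions. The factors e^(- lam) and e^lam appear because [tilt]
    leaves out e^(- lam k). *)
Lemma dtiltE lam t k x : dtilt lam t k x =
  expR (- lam) * tilt lam t (k + 1) x + expR lam * tilt lam t (k - 1) x
  + - 2 * tilt lam t k x.
Proof.
rewrite /tilt /dtilt.
have -> : (k + 1) * x - 2 * t * (sin x * sinh lam) =
  (k * x - 2 * t * (sin x * sinh lam)) + x by ring.
have -> : (k - 1) * x - 2 * t * (sin x * sinh lam) =
  (k * x - 2 * t * (sin x * sinh lam)) - x by ring.
move: (k * x - _) => A; rewrite cosD cosB.
move: (expR (- (t * _))) => E; rewrite /cosh /sinh; by field.
Qed.

Lemma norm_dtilt_le lam t k x (T : R) : `|t| <= T ->
  `|dtilt lam t k x| <= expR (T * (2 + 2 * cosh lam)) *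
     (2 * cosh lam + 2 + 2 * `|sinh lam|).
Proof.
move=> tT; rewrite /dtilt normrM ger0_norm ?expR_ge0//.
have T0 : 0 <= T := le_trans (normr_ge0 _) tT.
have c0 := cosh_ge1 lam.
have cc : `|cos x * cosh lam| <= cosh lam.
  rewrite normrM (ger0_norm (le_trans ler01 c0)) ler_piMl ?cos_max//.
  exact: le_trans c0.
have ss : `|sin x * sinh lam| <= `|sinh lam|.
  by rewrite normrM ler_piMl ?sin_max.
apply: ler_pM => //.
  rewrite ler_expR; apply: le_trans (ler_norm _) _; rewrite normrN normrM.
  apply: ler_pM => //; apply: le_trans (ler_normB _ _) _.
  by rewrite normrM (@ger0_norm _ 2)// lerD2l ler_wpM2l.
apply: (le_trans (ler_normD _ _)); apply: lerD; rewrite normrM.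
  apply: (@le_trans _ _ (`|2 * (cos x * cosh lam) - 2|)).
    by rewrite ler_piMr ?cos_max.
  apply: le_trans (ler_normB _ _) _.
  by rewrite normrM (@ger0_norm _ 2)// lerD2r ler_wpM2l.
apply: (@le_trans _ _ (`|2 * (sin x * sinh lam)|)).
  by rewrite ler_piMr ?sin_max.
by rewrite normrM (@ger0_norm _ 2)// ler_wpM2l.
Qed.

(** The Fourier integral along the line Im z = lam. That its value does not depend on [lam] for t >=
    0 is never shown by shifting contours; it comes out of [heat_prod]. *)
Definition heat1 lam t n : R := (2 * pi)^-1 * expR (- (lam * n%:~R)) *
  \int[mu]_(x in `[- pi, pi]) tilt lam t n%:~R x.

Lemma is_derive_heat1 lam t n :
  is_derive t 1 (fun t => heat1 lam t n)
   (heat1 lam t (n + 1) + heat1 lam t (n - 1) - 2 * heat1 lam t n).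
Proof.
have h : is_derive t 1 (fun t => \int[mu]_(x in `[- pi, pi]) tilt lam t n%:~R x)
    (\int[mu]_(x in `[- pi, pi]) dtilt lam t n%:~R x).
  apply: (@is_derive_Rintegral R (fun t x => tilt lam t n%:~R x)
    (fun t x => dtilt lam t n%:~R x)).
  - by move=> s x; exact: is_derive_tilt.
  - by move=> s; exact: continuous_tilt.
  - exists (expR ((`|t| + 1) * (2 + 2 * cosh lam)) *
     (2 * cosh lam + 2 + 2 * `|sinh lam|)).
      have := cosh_ge1 lam; have := normr_ge0 (sinh lam) => h1 h2.
      by rewrite mulr_ge0 ?expR_ge0//; lra.
    move=> s x st _; apply: norm_dtilt_le.
    have -> : s = (s - t) + t by ring.
    by apply: le_trans (ler_normD _ _) _; lra.
have e : \int[mu]_(x in `[- pi, pi]) dtilt lam t n%:~R x =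
   expR (- lam) * \int[mu]_(x in `[- pi, pi]) tilt lam t (n + 1)%:~R x +
   expR lam * \int[mu]_(x in `[- pi, pi]) tilt lam t (n - 1)%:~R x
   + - 2 * \int[mu]_(x in `[- pi, pi]) tilt lam t n%:~R x.
  have c1 c k : continuous (fun x => c * tilt lam t k x).
    by move=> x; apply: cvgM; [exact: cvg_cst|exact: continuous_tilt].
  rewrite intrD intrB.
  rewrite -!Rintegral_itvZ; try exact: continuous_tilt.
  rewrite -Rintegral_itvD; try exact: c1.
  rewrite -Rintegral_itvD; try exact: c1; last first.
    by move=> x; apply: cvgD; exact: c1.
  by apply: eq_Rintegral => x _; rewrite dtiltE.
rewrite /heat1; apply: is_derive_eq; rewrite /GRing.scale /= e.
rewrite intrD intrB !mulrDr !mulrN1 !mulr1 !opprD !opprK !expRD.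
move: (\int[mu]_(x in _) _) (\int[mu]_(x in _) _) (\int[mu]_(x in _) _) => I1 I2 I3.
have := expRxMexpNx_1 lam; move: (expR lam) (expR (- lam)) => u v uv.
ring.
Qed.

Lemma sin_intr_pi n : sin (n%:~R * pi) = 0 :> R.
Proof.
have h (m : nat) : sin (m%:R * pi) = 0 :> R.
  elim: m => [|m IH]; first by rewrite mul0r sin0.
  by rewrite -natr1 mulrDl mul1r sinDpi IH oppr0.
case: n => m; first exact: h.
by rewrite NegzE mulrNz mulNr sinN h oppr0.
Qed.

(** At time 0 the tilt disappears from the integrand and cos(n x) is integrated over a full period.
    The prefactor e^(- lam n) is harmless: it is 1 at n = 0 and multiplies 0 elsewhere. *)
Lemma heat1_0 lam n : heat1 lam 0 n = (n == 0)%:R.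
Proof.
have p0 : 0 < pi :> R := pi_gt0 R.
have pp : - pi < pi :> R by lra.
rewrite /heat1.
have -> : \int[mu]_(x in `[- pi, pi]) tilt lam 0 n%:~R x =
   \int[mu]_(x in `[- pi, pi]) cos (n%:~R * x).
  by apply: eq_Rintegral => x _; rewrite /tilt mul0r oppr0 expR0 mul1r mulr0 mul0r subr0.
have ccos : continuous (fun x : R => cos (n%:~R * x)).
  by move=> x; apply/differentiable_continuous/derivable1_diffP; apply: ex_derive.
have [->|n0] := eqVneq n 0.
  have d0 x : is_derive x 1 (id : R -> R) (cos (0%:~R * x)).
    by rewrite mul0r cos0; exact: is_derive_id.
  have c0 : continuous (fun x : R => cos (0%:~R * x)).
    by move=> x; apply/differentiable_continuous/derivable1_diffP; apply: ex_derive.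
  rewrite (Rintegral_itv_FTC pp c0 d0) mulr0 oppr0 expR0 mulr1 opprK.
  have -> : pi + pi = 2 * pi :> R by rewrite mulr_natl mulr2n.
  by rewrite mulVf// mulf_neq0// lt0r_neq0.
have nR0 : n%:~R != 0 :> R by rewrite intr_eq0.
have dn x : is_derive x 1 (fun x : R => (n%:~R)^-1 * sin (n%:~R * x)) (cos (n%:~R * x)).
  apply: is_derive_eq; rewrite /GRing.scale /=.
  move: nR0; move: (n%:~R : R) => u u0; by field.
rewrite (Rintegral_itv_FTC pp ccos dn) mulrN sinN sin_intr_pi oppr0 mulr0 subrr.
by rewrite mulr0.
Qed.

(** The trade-off of the tilt: the second factor is the decay gained, the first its price, obtained
    from cos x cosh lam <= cosh lam. *)
Lemma heat1_le lam t n : 0 <= t ->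
  `|heat1 lam t n| <= expR (2 * t * (cosh lam - 1)) * expR (- (lam * n%:~R)).
Proof.
move=> t0; have p0 : 0 < pi :> R := pi_gt0 R.
have pp : - pi < pi :> R by lra.
rewrite /heat1 !normrM (ger0_norm (expR_ge0 _)) ger0_norm; last by rewrite invr_ge0; lra.
rewrite mulrAC ler_wpM2r ?expR_ge0// mulrC.
set K := expR _.
have cK : continuous (fun _ : R => K) by move=> x; exact: cvg_cst.
have h : `|\int[mu]_(x in `[- pi, pi]) tilt lam t n%:~R x| <=
    \int[mu]_(x in `[- pi, pi]) (fun=> K) x.
  apply: norm_Rintegral_itv_le => //; first exact: continuous_tilt.
  move=> x _; rewrite /tilt normrM (ger0_norm (expR_ge0 _)).
  rewrite -[leRHS]mulr1; apply: ler_pM; rewrite ?expR_ge0 ?cos_max//.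
  rewrite ler_expR.
  have c1 := cosh_ge1 lam; have c2 := cos_le1 x.
  have h1 : cos x * cosh lam <= cosh lam by rewrite ler_piMl//; lra.
  have : 0 <= t * (cosh lam - cos x * cosh lam) by rewrite mulr_ge0//; lra.
  lra.
have dK x : is_derive x 1 (fun y : R => y * K) K.
  by apply: is_derive_eq; rewrite /GRing.scale /=; ring.
rewrite (Rintegral_itv_FTC pp cK dK) in h.
rewrite ler_pdivrMr; last by rewrite mulr_gt0.
by apply: le_trans h _; rewrite mulNr opprK -mulrDl -mulr2n -[pi *+ 2]mulr_natl mulrC.
Qed.

(** * Factorization of the kernel, with a free tilt in each coordinate *)

Variable d : nat.
Notation pt := 'rV[int]_d.

(** The product of one-dimensional solutions solves the d-dimensional equation by the Leibniz rule,
    and [heat1_le] bounds it by an exponential weight, so [heat_unique] applies. Since the left side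
    is free of [lam], the tilts may afterwards be chosen depending on t and on the point z at which
    the kernel is estimated. *)
Lemma heat_prod (lam : 'I_d -> R) t (z : pt) : 0 <= t ->
  heat t z = \prod_(i < d) heat1 (lam i) t (z 0 i).
Proof.
move=> t0.
have zp (y : pt) i j : (y + unitv i) 0 j = y 0 j + (j == i)%:R.
  by rewrite !mxE eqxx.
have zm (y : pt) i j : (y - unitv i) 0 j = y 0 j - (j == i)%:R.
  by rewrite !mxE eqxx.
pose f s (y : pt) := \prod_(i < d) heat1 (lam i) s (y 0 i).
pose W (y : pt) := \prod_(i < d) expR (- (lam i * (y 0 i)%:~R)).
(* One factor that dominates the change of W under a step in any coordinate direction. *)
pose q := expR (\sum_(i < d) `|lam i|).
pose A := \prod_(i < d) expR (2 * t * (cosh (lam i) - 1)).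
have lamq i : expR `|lam i| <= q.
  by rewrite ler_expR (bigD1 i)//= lerDl sumr_ge0.
have W0 (y : pt) : 0 <= W y by apply: prodr_ge0 => i _; exact: expR_ge0.
have Wstep (y y' : pt) i (e : int) : `|e%:~R : R| <= 1 ->
    (forall j, y' 0 j = y 0 j + (if j == i then e else 0)) -> W y' <= q * W y.
  move=> e1 hy.
  have -> : W y' = expR (- (lam i * e%:~R)) * W y.
    rewrite /W (bigD1 i)//= [in RHS](bigD1 i)//= hy eqxx intrD mulrDr opprD expRD.
    rewrite mulrA [X in X * _]mulrC; congr (_ * _).
    by apply: eq_bigr => j /negbTE ji; rewrite hy ji addr0.
  apply: ler_wpM2r => //; apply: le_trans (lamq i); rewrite ler_expR.
  apply: le_trans (ler_norm _) _; rewrite normrN normrM ler_piMr//.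
apply: (@heat_unique R d f W q A t) => //.
- exact: expR_ge0.
- by apply: prodr_ge0 => i _; exact: expR_ge0.
- move=> y i; apply: (Wstep _ _ i 1); first by rewrite normr1.
  by move=> j; rewrite zp; case: eqP.
- move=> y i; apply: (Wstep _ _ i (-1)); first by rewrite normrN normr1.
  by move=> j; rewrite zm; case: eqP => _; rewrite ?oppr0.
- move=> s y.
  have := @is_derive_prod R d (fun i s => heat1 (lam i) s (y 0 i))
    (fun i => heat1 (lam i) s (y 0 i + 1) + heat1 (lam i) s (y 0 i - 1)
       - 2 * heat1 (lam i) s (y 0 i)) s (fun i => is_derive_heat1 _ _ _).
  suff -> : - lap (f s) y = \sum_(i < d) \prod_(j < d) (if j == i then
      heat1 (lam j) s (y 0 j + 1) + heat1 (lam j) s (y 0 j - 1)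
       - 2 * heat1 (lam j) s (y 0 j) else heat1 (lam j) s (y 0 j)) by [].
  rewrite /lap -sumrN; apply: eq_bigr => i _.
  rewrite /f (bigD1 i)//= [X in - (_ - X + _)](bigD1 i)//= [X in - (_ + (_ - X))](bigD1 i)//=.
  rewrite [in RHS](bigD1 i)//= eqxx zp zm eqxx.
  have -> : \prod_(j < d | j != i) heat1 (lam j) s ((y + unitv i) 0 j) =
            \prod_(j < d | j != i) heat1 (lam j) s (y 0 j).
    by apply: eq_bigr => j /negbTE ji; rewrite zp ji addr0.
  have -> : \prod_(j < d | j != i) heat1 (lam j) s ((y - unitv i) 0 j) =
            \prod_(j < d | j != i) heat1 (lam j) s (y 0 j).
    by apply: eq_bigr => j /negbTE ji; rewrite zm ji subr0.
  have -> : \prod_(j < d | j != i) (if j == i then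
      heat1 (lam j) s (y 0 j + 1) + heat1 (lam j) s (y 0 j - 1)
       - 2 * heat1 (lam j) s (y 0 j) else heat1 (lam j) s (y 0 j)) =
            \prod_(j < d | j != i) heat1 (lam j) s (y 0 j).
    by apply: eq_bigr => j /negbTE ->.
  ring.
- move=> y; rewrite /f /ind0.
  have [->|y0] := eqVneq y 0.
    by rewrite big1// => i _; rewrite heat1_0 mxE eqxx.
  have [i yi] : exists i, y 0 i != 0.
    apply/existsP; rewrite -[X in is_true X]negbK negb_exists; apply/negP => /forallP h.
    move/eqP: y0; apply; apply/rowP => i; rewrite mxE.
    by have := h i; rewrite negbK => /eqP.
  by rewrite (bigD1 i)//= heat1_0 (negbTE yi) mul0r.
- move=> s y /andP[s0 st]; rewrite /f /A /W -big_split/= normr_prod.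
  apply: ler_prod => i _; rewrite normr_ge0/=; apply: le_trans (heat1_le _ _ s0) _.
  rewrite ler_wpM2r ?expR_ge0// ler_expR.
  by rewrite ler_wpM2r ?subr_ge0 ?cosh_ge1//; lra.
Qed.

End tilted_fourier.

(** * Comparison with the Gaussian kernel *)

Section local_limit.
Variable R : realType.
Notation mu := (@lebesgue_measure R).
Implicit Types (lam t k x y s L : R) (n : int).

Let cgauss t y x : R := expR (- (t * x ^+ 2)) * cos (y * x).

Lemma continuous_cgauss t y : continuous (cgauss t y).
Proof.
by move=> x; rewrite /cgauss; apply/differentiable_continuous/derivable1_diffP; apply: ex_derive.
Qed.

(* [y |-> exp (y^2 / 4t) \int_{-L}^L cos (y x) exp (- t x^2) dx] has derivative
   [exp (y^2 / 4t) sin (y L) exp (- t L^2) / t], small for large [L]. *)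
Lemma truncated_gauss_fourier t y L : 0 < t -> 0 < L ->
  `|\int[mu]_(x in `[- L, L]) cgauss t y x -
    expR (- (y ^+ 2 / (4 * t))) * \int[mu]_(x in `[- L, L]) expR (- (t * x ^+ 2))|
  <= expR (- (t * L ^+ 2)) / t * `|y|.
Proof.
move=> t0 L0; have LL : - L < L by lra.
have tn0 : t != 0 by rewrite lt0r_neq0.
pose F y := \int[mu]_(x in `[- L, L]) cgauss t y x.
pose dc y x := expR (- (t * x ^+ 2)) * (- (x * sin (y * x))).
have dF s : is_derive s 1 F (\int[mu]_(x in `[- L, L]) dc s x).
  apply: (@is_derive_Rintegral R (fun s x => cgauss t s x) (fun s x => dc s x)).
  - move=> r x; rewrite /cgauss /dc; apply: is_derive_eq; rewrite /GRing.scale /=; ring.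
  - by move=> r; exact: continuous_cgauss.
  - exists L; first exact: ltW.
    move=> r x _ xL; rewrite /dc normrM normrN normrM (ger0_norm (expR_ge0 _)).
    rewrite -[leRHS]mul1r; apply: ler_pM => //.
      by rewrite expR_le1 oppr_le0 mulr_ge0 ?sqr_ge0// ltW.
    by rewrite -[leRHS]mulr1; apply: ler_pM => //; [rewrite ler_norml|exact: sin_max].
have cdc s : continuous (dc s).
  move=> x; rewrite /dc; apply/differentiable_continuous/derivable1_diffP; apply: ex_derive.
(* The Gaussian differential equation F' + s F / (2 t) = boundary term: the combined integrand is
   the x-derivative of sin(s x) e^(- t x^2) / (2 t), so only the end points contribute. *)
have FE s : \int[mu]_(x in `[- L, L]) dc s x + s / (2 * t) * F s =
    sin (s * L) * expR (- (t * L ^+ 2)) / t.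
  rewrite -Rintegral_itvZ; last exact: continuous_cgauss.
  rewrite -Rintegral_itvD; last 2 first.
  - exact: cdc.
  - by move=> x; apply: cvgM; [exact: cvg_cst|exact: continuous_cgauss].
  have dA x : is_derive x 1 (fun x => (2 * t)^-1 * (sin (s * x) * expR (- (t * x ^+ 2))))
      (dc s x + s / (2 * t) * cgauss t s x).
    by rewrite /dc /cgauss; apply: is_derive_eq; rewrite /GRing.scale /=; field.
  have cA : continuous (fun x => dc s x + s / (2 * t) * cgauss t s x).
    move=> x; apply: cvgD; first exact: cdc.
    by apply: cvgM; [exact: cvg_cst|exact: continuous_cgauss].
  rewrite (Rintegral_itv_FTC LL cA dA) mulrN sinN sqrrN.
  by field.
pose H s := expR (s ^+ 2 / (4 * t)) * F s - F 0.
have dH s : is_derive s 1 H (expR (s ^+ 2 / (4 * t)) *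
    (sin (s * L) * expR (- (t * L ^+ 2)) / t)).
  have h := dF s; rewrite /H -FE; apply: is_derive_eq; rewrite /GRing.scale /=.
  by field.
have F0 : F 0 = \int[mu]_(x in `[- L, L]) expR (- (t * x ^+ 2)).
  by apply: eq_Rintegral => x _; rewrite /cgauss mul0r cos0 mulr1.
have hH : `|H y| <= expR (y ^+ 2 / (4 * t)) * (expR (- (t * L ^+ 2)) / t) * `|y| ^+ 1.
  apply: (@is_derive_norm_le R H _ _ `|y| 0 _ _ dH) => //.
  - by rewrite mulr_ge0 ?divr_ge0 ?expR_ge0// ltW.
  - by rewrite /H expr0n/= mul0r expR0 mul1r subrr.
  move=> s sy; rewrite expr0 mulr1 normrM (ger0_norm (expR_ge0 _)).
  apply: ler_pM => //.
    rewrite ler_expR ler_wpM2r ?invr_ge0 ?mulr_ge0 ?(ltW t0)//.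
    by rewrite -(real_normK (num_real s)) -(real_normK (num_real y)) lerXn2r ?nnegrE.
  rewrite !normrM (ger0_norm (expR_ge0 _)) (@ger0_norm _ t^-1) ?invr_ge0 ?(ltW t0)//.
  rewrite ler_wpM2r ?invr_ge0 ?(ltW t0)// ler_piMl ?expR_ge0 ?sin_max//.
have -> : F y - expR (- (y ^+ 2 / (4 * t))) * \int[mu]_(x in `[- L, L]) expR (- (t * x ^+ 2))
   = expR (- (y ^+ 2 / (4 * t))) * H y.
  by rewrite /H -F0 mulrBr mulrA [_ * expR (_ / _)]mulrC expRxMexpNx_1 mul1r.
rewrite normrM (ger0_norm (expR_ge0 _)).
apply: le_trans (ler_wpM2l (expR_ge0 _) hH) _.
by rewrite expr1 !mulrA [_ * expR (_ / _)]mulrC expRxMexpNx_1 mul1r.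
Qed.

Lemma gauss_fourier_cvg t y : 0 < t ->
  \int[mu]_(x in `[- m.+1%:R, m.+1%:R]) cgauss t y x @[m --> \oo] -->
  expR (- (y ^+ 2 / (4 * t))) * (Num.sqrt pi / Num.sqrt t).
Proof.
move=> t0.
have c1 : expR (- (y ^+ 2 / (4 * t))) *
    (\int[mu]_(x in `[- m.+1%:R, m.+1%:R]) expR (- (t * x ^+ 2))) @[m --> \oo] -->
    expR (- (y ^+ 2 / (4 * t))) * (Num.sqrt pi / Num.sqrt t).
  by apply: cvgM; [exact: cvg_cst|exact: Rintegral_gauss_cvg].
have c0 : \int[mu]_(x in `[- m.+1%:R, m.+1%:R]) cgauss t y x -
    expR (- (y ^+ 2 / (4 * t))) *
    (\int[mu]_(x in `[- m.+1%:R, m.+1%:R]) expR (- (t * x ^+ 2))) @[m --> \oo] --> (0 : R).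
  apply: norm_cvg0.
  have hz : (t^-1 / t * `|y|) * harmonic m @[m --> \oo] --> (0 : R).
    rewrite -(mulr0 (t^-1 / t * `|y|)).
    by apply: cvgM; [exact: cvg_cst|exact: cvg_harmonic].
  apply: (@squeeze_cvgr _ _ _ _ (cst 0) _ _ _ _ _ hz); last exact: cvg_cst.
  apply: nearW => m /=; rewrite normr_ge0/=.
  apply: le_trans (truncated_gauss_fourier y t0 _) _ => //.
  have -> : t^-1 / t * `|y| / m.+1%:R = (t * m.+1%:R)^-1 / t * `|y|.
    by rewrite invfM; ring.
  rewrite ler_wpM2r// ler_wpM2r ?invr_ge0 ?(ltW t0)//.
  rewrite expRN lef_pV2 ?posrE ?expR_gt0 ?mulr_gt0//.
  apply: le_trans (expR_ge1Dx _); apply: (@le_trans _ _ (t * m.+1%:R ^+ 2)); last by rewrite lerDr.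
  rewrite ler_pM2l// -natrX ler_nat; nia.
rewrite -[X in _ --> X]add0r.
have -> : (fun m : nat => \int[mu]_(x in `[- m.+1%:R, m.+1%:R]) cgauss t y x) =
  (fun m : nat => (\int[mu]_(x in `[- m.+1%:R, m.+1%:R]) cgauss t y x -
    expR (- (y ^+ 2 / (4 * t))) *
    (\int[mu]_(x in `[- m.+1%:R, m.+1%:R]) expR (- (t * x ^+ 2)))) +
    expR (- (y ^+ 2 / (4 * t))) *
    (\int[mu]_(x in `[- m.+1%:R, m.+1%:R]) expR (- (t * x ^+ 2)))).
  by apply/funext => m; rewrite subrK.
by apply: cvgD.
Qed.

(** The analogue of [tilt] with 2 - 2 cos z replaced by z^2: the real part of exp(i k z - t z^2) at
    z = x + i lam, again without the factor e^(- lam k). *)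
Definition gtilt lam t k x : R :=
  expR (- (t * (x ^+ 2 - lam ^+ 2))) * cos (k * x - 2 * t * (x * lam)).

Definition gauss1 t k : R := (2 * Num.sqrt pi * Num.sqrt t)^-1 * expR (- (k ^+ 2 / (4 * t))).

Lemma continuous_gtilt lam t k : continuous (gtilt lam t k).
Proof.
by move=> x; rewrite /gtilt; apply/differentiable_continuous/derivable1_diffP; apply: ex_derive.
Qed.

(** The tilted Gaussian is e^(t lam^2) times an untilted one at the frequency k - 2 t lam. Expanding
    (k - 2 t lam)^2 / (4 t), all terms in lam cancel against e^(- lam k), so no contour is moved
    here either. *)
Lemma gtilt_cvg lam t k : 0 < t ->
  (2 * pi)^-1 * expR (- (lam * k)) *
  \int[mu]_(x in `[- m.+1%:R, m.+1%:R]) gtilt lam t k x @[m --> \oo] --> gauss1 t k.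
Proof.
move=> t0; have tn0 : t != 0 by rewrite lt0r_neq0.
have sp0 : 0 < Num.sqrt pi :> R by rewrite sqrtr_gt0 pi_gt0.
have st0 : 0 < Num.sqrt t by rewrite sqrtr_gt0.
have e m : \int[mu]_(x in `[- m.+1%:R, m.+1%:R]) gtilt lam t k x =
  expR (t * lam ^+ 2) * \int[mu]_(x in `[- m.+1%:R, m.+1%:R]) cgauss t (k - 2 * t * lam) x.
  rewrite -Rintegral_itvZ; last exact: continuous_cgauss.
  apply: eq_Rintegral => x _; rewrite /gtilt /cgauss [RHS]mulrA -expRD.
  by congr (expR _ * cos _); ring.
have -> : gauss1 t k = (2 * pi)^-1 * expR (- (lam * k)) * (expR (t * lam ^+ 2) *
    (expR (- ((k - 2 * t * lam) ^+ 2 / (4 * t))) * (Num.sqrt pi / Num.sqrt t))).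
  rewrite /gauss1.
  have -> : - (k ^+ 2 / (4 * t)) = - (lam * k) + (t * lam ^+ 2 +
      (- ((k - 2 * t * lam) ^+ 2 / (4 * t)))) by field.
  rewrite !expRD; have {2}-> : pi = Num.sqrt pi ^+ 2 :> R by rewrite sqr_sqrtr// pi_ge0.
  move: (expR _) (expR _) (expR _) => e1 e2 e3.
  move: (Num.sqrt pi) (Num.sqrt t) sp0 st0 => u v u0 v0.
  by field; rewrite !lt0r_neq0.
under eq_cvg do rewrite e.
by do 2 (apply: cvgM; first exact: cvg_cst); exact: gauss_fourier_cvg.
Qed.

(** The value (4 * 3)^3: the cubic case of [expr_le_expR] at (1 + w) / 4. In [Ctilt], 16 is the
    constant of the polynomial bound on the errors, and e^9 collects e^8 from the price of the tilt
    and e from 1 + w. *)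
Definition Ccube : R := 12 ^+ 3.
Definition Ctilt : R := 16 * (Ccube * expR 9).

Lemma Ccube_ge0 : 0 <= Ccube. Proof. by rewrite exprn_ge0. Qed.

Lemma cube_expR_le (w : R) : 0 <= w -> (1 + w) ^+ 3 <= Ccube * (expR 1 * expR (w / 4)).
Proof.
move=> w0; have h0 : 0 <= (1 + w) / 4 by rewrite divr_ge0// addr_ge0.
have h := expr_le_expR 2 h0.
have h2 : expR ((1 + w) / 4) <= expR 1 * expR (w / 4).
  by rewrite -expRD ler_expR; lra.
have -> : (1 + w) ^+ 3 = 4 ^+ 3 * ((1 + w) / 4) ^+ 3 by field.
have -> : Ccube = 4 ^+ 3 * 3 ^+ 3 by rewrite /Ccube -exprMn -natrM.
rewrite -mulrA ler_wpM2l ?exprn_ge0//; apply: le_trans h _.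
by rewrite ler_wpM2l ?exprn_ge0.
Qed.

Lemma tilt_gtilt_le lam t k x : 1 <= t -> t * lam ^+ 2 = 1 -> `|x| <= pi ->
  `|tilt lam t k x - gtilt lam t k x| <= Ctilt / t * (1 + t * x ^+ 2)^-1.
Proof.
move=> t1 tl xp; have t0 : 0 < t by apply: lt_le_trans t1.
have l2 : lam ^+ 2 <= 1.
  rewrite -(@ler_pM2l _ t)// tl mulr1//.
have l1 : `|lam| <= 1.
  by rewrite -(@ler_pXn2r _ 2) ?nnegrE// expr1n real_normK ?num_real.
set w := t * x ^+ 2.
have w0 : 0 <= w by rewrite mulr_ge0 ?sqr_ge0// ltW.
have c1 := cosh_ge1 lam; have c4 := cosh_le4 l1.
have sc := sub_cos_ge xp.
(* The 8 is the price of the tilt, 2 t (cosh lam - 1) <= 8 t lam^2; the term - w / 4 is twice t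
   times the lower bound x^2 / 8 for 1 - cos x. *)
have am : - (t * (2 - 2 * (cos x * cosh lam))) <= 8 - w / 4.
  have h1 : cosh lam - 1 <= 4 * lam ^+ 2.
    have := cosh_sub1_le l1; rewrite real_normK ?num_real// => /(le_trans (ler_norm _)).
    by [].
  have h2 : t * (cosh lam - 1) <= 4.
    by have := ler_wpM2l (ltW t0) h1; lra.
  have h3 : t * (x ^+ 2 / 8) <= t * (cosh lam * (1 - cos x)).
    rewrite ler_pM2l//; apply: le_trans sc _; rewrite ler_peMl// subr_ge0; exact: cos_le1.
  have -> : - (t * (2 - 2 * (cos x * cosh lam))) =
     2 * (t * (cosh lam - 1)) - 2 * (t * (cosh lam * (1 - cos x))) by ring.
  by rewrite /w; lra.
have bm : - (t * (x ^+ 2 - lam ^+ 2)) <= 8 - w / 4.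
  by rewrite mulrBr tl -/w; lra.
have := expR_cos_dist (k * x - 2 * t * (sin x * sinh lam)) (k * x - 2 * t * (x * lam)) am bm.
rewrite -/(tilt lam t k x) -/(gtilt lam t k x) => h; apply: le_trans h _.
set X := `|x|; set Y := `|lam|.
have X0 : 0 <= X by exact: normr_ge0.
have Y0 : 0 <= Y by exact: normr_ge0.
have X2 : x ^+ 2 = X ^+ 2 by rewrite /X real_normK ?num_real.
have Y2 : lam ^+ 2 = Y ^+ 2 by rewrite /Y real_normK ?num_real.
have tY : t * Y ^+ 2 = 1 by rewrite -Y2.
have hA : `|- (t * (2 - 2 * (cos x * cosh lam))) - - (t * (x ^+ 2 - lam ^+ 2))| <=
    8 * t * (X ^+ 4 + X ^+ 2 * Y ^+ 2 + Y ^+ 4).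
  have r1 := cos_sub_taylor2_le x; have r2 := cosh_sub_taylor2_le l1.
  rewrite -/X -/Y in r1 r2.
  set c := cos x - (1 - x ^+ 2 / 2) in r1; set e := cosh lam - (1 + lam ^+ 2 / 2) in r2.
  have -> : - (t * (2 - 2 * (cos x * cosh lam))) - - (t * (x ^+ 2 - lam ^+ 2)) =
    t * (2 * (c * cosh lam) + 2 * e - x ^+ 2 * e - x ^+ 2 * lam ^+ 2 / 2).
    by rewrite /c /e; field.
  have -> : 8 * t * (X ^+ 4 + X ^+ 2 * Y ^+ 2 + Y ^+ 4) =
    t * (8 * (X ^+ 4 + X ^+ 2 * Y ^+ 2 + Y ^+ 4)) by ring.
  rewrite normrM (gtr0_norm t0) ler_pM2l//.
  have b1 : `|c * cosh lam| <= 4 * X ^+ 4.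
    rewrite normrM mulrC; apply: ler_pM => //; exact: norm_cosh_le.
  have b2 : `|x ^+ 2 * e| <= 4 * (X ^+ 2 * Y ^+ 2).
    rewrite normrM X2 (ger0_norm (sqr_ge0 X)).
    have : `|e| <= 4 * Y ^+ 2.
      apply: le_trans r2 _; rewrite ler_pM2l//.
      have -> : Y ^+ 4 = Y ^+ 2 * Y ^+ 2 by rewrite -exprD.
      by rewrite ler_piMl ?sqr_ge0// -Y2.
    move=> /(ler_wpM2l (sqr_ge0 X)); lra.
  have b3 : `|x ^+ 2 * lam ^+ 2 / 2| <= X ^+ 2 * Y ^+ 2.
    rewrite X2 Y2 ger0_norm ?divr_ge0 ?mulr_ge0 ?sqr_ge0//.
    by rewrite ler_pdivrMr// ler_peMr ?mulr_ge0 ?sqr_ge0// ler1n.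
  move: b1 b2 b3 r2; rewrite !ler_norml.
  have p4 : 0 <= X ^+ 2 * Y ^+ 2 by rewrite mulr_ge0 ?sqr_ge0.
  move=> /andP[? ?] /andP[? ?] /andP[? ?] /andP[? ?]; apply/andP; split; lra.
have hB : `|k * x - 2 * t * (sin x * sinh lam) - (k * x - 2 * t * (x * lam))| <=
    8 * t * (X ^+ 3 * Y + X * Y ^+ 3).
  have r1 := sin_subid_le x; have r2 := sinh_subid_le l1; have r3 := norm_sinh_le l1.
  rewrite -/X -/Y in r1 r2 r3.
  have -> : k * x - 2 * t * (sin x * sinh lam) - (k * x - 2 * t * (x * lam)) =
    - (2 * t * ((sin x - x) * sinh lam + x * (sinh lam - lam))) by ring.
  rewrite normrN normrM (ger0_norm (mulr_ge0 (ler0n _ 2) (ltW t0))).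
  have h1 : `|(sin x - x) * sinh lam + x * (sinh lam - lam)| <=
     X ^+ 3 * (4 * Y) + X * (4 * Y ^+ 3).
    by apply: le_trans (ler_normD _ _) _; apply: lerD; rewrite normrM; apply: ler_pM.
  have := ler_wpM2l (mulr_ge0 (ler0n R 2) (ltW t0)) h1; lra.
have s0 : 0 < Num.sqrt t by rewrite sqrtr_gt0.
have st : t = Num.sqrt t ^+ 2 by rewrite sqr_sqrtr// ltW.
have sY : Num.sqrt t * Y = 1.
  apply/eqP; rewrite -(@eqrXn2 _ 2) ?mulr_ge0 ?(ltW s0)// exprMn -st tY expr1n//.
set v := Num.sqrt t * X.
have v0 : 0 <= v by rewrite mulr_ge0// ltW.
have wv : w = v ^+ 2 by rewrite /w /v exprMn -st X2.
(* With X = v / sqrt t and Y = 1 / sqrt t every quartic monomial carries t^(-2), so a factor 1 / t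
   survives. *)
have eqAB : 8 * t * (X ^+ 4 + X ^+ 2 * Y ^+ 2 + Y ^+ 4) + 8 * t * (X ^+ 3 * Y + X * Y ^+ 3) =
   8 / t * (v ^+ 4 + v ^+ 2 + 1 + v ^+ 3 + v).
  have Yi : Y = (Num.sqrt t)^-1 by rewrite -[LHS](mulKf (lt0r_neq0 s0)) sY mulr1.
  rewrite /v Yi st; move: (Num.sqrt t) s0 => r r0.
  rewrite sqrtr_sqr gtr0_norm//; by field; rewrite lt0r_neq0.
have hAB : 8 / t * (v ^+ 4 + v ^+ 2 + 1 + v ^+ 3 + v) <= 16 / t * (1 + w) ^+ 2.
  have : v ^+ 4 + v ^+ 2 + 1 + v ^+ 3 + v <= 2 * (1 + w) ^+ 2.
    (* Expanded, this square bounds the odd powers: 2 (v + v^3) <= 1 + 2 v^2 + v^4. *)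
    rewrite wv; have : 0 <= (1 - v) ^+ 2 * (1 + v ^+ 2) by rewrite mulr_ge0 ?sqr_ge0 ?addr_ge0 ?sqr_ge0.
    have : 0 <= v ^+ 2 by exact: sqr_ge0.
    have : 0 <= v ^+ 4 by rewrite exprn_ge0.
    lra.
  have t8 : 0 <= 8 / t by rewrite divr_ge0// ltW.
  by move=> /(ler_wpM2l t8); lra.
apply: (@le_trans _ _ (expR (8 - w / 4) * (16 / t * (1 + w) ^+ 2))).
  rewrite ler_wpM2l ?expR_ge0//; apply: le_trans (lerD hA hB) _.
  by rewrite eqAB.
have w1 : 0 < 1 + w by lra.
rewrite ler_pdivlMr// /Ctilt.
have h9 : expR (8 - w / 4) * (Ccube * (expR 1 * expR (w / 4))) = Ccube * expR 9.
  rewrite mulrCA -!expRD; congr (_ * expR _); lra.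
have := ler_wpM2l (expR_ge0 (8 - w / 4)) (cube_expR_le w0); rewrite h9 => hc.
have t16 : 0 <= 16 / t by rewrite divr_ge0// ltW.
have := ler_wpM2l t16 hc; move: (expR (8 - w / 4)) (expR 9) => e1 e2 hf.
have -> : e1 * (16 / t * (1 + w) ^+ 2) * (1 + w) = 16 / t * (e1 * (1 + w) ^+ 3) by ring.
by apply: le_trans hf _; rewrite le_eqVlt; apply/orP; left; apply/eqP; ring.
Qed.

Lemma Ctilt_ge0 : 0 <= Ctilt.
Proof. by rewrite /Ctilt !mulr_ge0 ?expR_ge0 ?Ccube_ge0. Qed.

(** Beyond the period there is nothing to compare with, so the Gaussian itself is the error. There w
    = t x^2 >= t, so its exponential smallness in w also pays for the factor 1 / t. *)
Lemma gtilt_tail_le lam t k x : 1 <= t -> t * lam ^+ 2 = 1 -> 1 <= `|x| ->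
  `|gtilt lam t k x| <= Ctilt / t * (1 + t * x ^+ 2)^-1.
Proof.
move=> t1 tl x1; have t0 : 0 < t by apply: lt_le_trans t1.
set w := t * x ^+ 2.
have tw : t <= w.
  by rewrite /w ler_peMr ?(ltW t0)// -(real_normK (num_real x)) exprn_ege1.
have w0 : 0 <= w by lra.
apply: (@le_trans _ _ (expR (1 - w))).
  rewrite /gtilt normrM (ger0_norm (expR_ge0 _)) -[leRHS]mulr1.
  apply: ler_pM => //; last exact: cos_max.
  by rewrite ler_expR mulrBr tl -/w; lra.
have w1 : 0 < 1 + w by lra.
rewrite ler_pdivlMr// ler_pdivlMr//.
have h : t * (1 + w) <= Ccube * (expR 1 * expR (w / 4)).
  apply: le_trans (cube_expR_le w0); nra.
have := ler_wpM2l (expR_ge0 (1 - w)) h.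
have -> : expR (1 - w) * (Ccube * (expR 1 * expR (w / 4))) = Ccube * expR (2 - 3 / 4 * w).
  by rewrite mulrCA -!expRD; congr (_ * expR _); field.
move=> hh; rewrite -mulrA [(1 + w) * t]mulrC; apply: le_trans hh _.
have : expR (2 - 3 / 4 * w) <= expR 9 by rewrite ler_expR; lra.
move=> /(ler_wpM2l Ccube_ge0) h9; apply: le_trans h9 _.
rewrite /Ctilt; have : 0 <= Ccube * expR 9 by rewrite mulr_ge0 ?expR_ge0 ?Ccube_ge0.
by move: (Ccube * _) => u u0; lra.
Qed.

(** Extending [tilt] by zero puts both integrals on [- L, L], where the inner and the tail estimates
    share one majorant. Its arctangent integral is bounded independently of L. *)
Lemma Rintegral_tilt_gtilt_le lam t k L : 1 <= t -> t * lam ^+ 2 = 1 -> pi <= L ->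
  `|\int[mu]_(x in `[- pi, pi]) tilt lam t k x -
    \int[mu]_(x in `[- L, L]) gtilt lam t k x| <= Ctilt / t * (pi / Num.sqrt t).
Proof.
move=> t1 tl pL; have t0 : 0 < t by apply: lt_le_trans t1.
have L0 : 0 < L by apply: lt_le_trans pL; exact: pi_gt0.
set D : set (measurableTypeR R) := `[- L, L]%classic.
set P : set (measurableTypeR R) := `[- pi, pi]%classic.
have mD : measurable D by exact: measurable_itv.
have mP : measurable P by exact: measurable_itv.
have DP : D `&` P = P.
  apply/setIidPr => x; rewrite /D /P/= !in_itv/= => /andP[h1 h2]; apply/andP; split; lra.
pose T := tilt lam t k \_ P.
have iT : mu.-integrable D (EFin \o T).
  rewrite /T -restrict_EFin; apply/integrable_restrict => //.
  by rewrite DP; apply: continuous_integrable_itv; exact: continuous_tilt.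
have iG : mu.-integrable D (EFin \o gtilt lam t k).
  by apply: continuous_integrable_itv; exact: continuous_gtilt.
have cS : continuous (fun x => Ctilt / t * (1 + t * x ^+ 2)^-1).
  move=> x; apply: cvgM; first exact: cvg_cst.
  apply: cvgV; first by rewrite lt0r_neq0// ltr_pwDl// mulr_ge0 ?sqr_ge0// ltW.
  apply: cvgD; first exact: cvg_cst.
  by apply: cvgM; [exact: cvg_cst|exact: exprn_continuous].
have iS : mu.-integrable D (EFin \o (fun x => Ctilt / t * (1 + t * x ^+ 2)^-1)).
  exact: continuous_integrable_itv.
have -> : \int[mu]_(x in `[- pi, pi]) tilt lam t k x = \int[mu]_(x in D) T x.
  by rewrite -[in LHS]/P -DP Rintegral_mkcondr.
rewrite -RintegralB//.
have iTG : mu.-integrable D (EFin \o (fun x => T x - gtilt lam t k x)).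
  by have := integrableB mD iT iG.
apply: le_trans (le_normr_Rintegral mD iTG) _.
apply: (@le_trans _ _ (\int[mu]_(x in D) (Ctilt / t * (1 + t * x ^+ 2)^-1))).
  apply: le_Rintegral => //.
    by have := integrable_norm iTG.
  move=> x Dx; rewrite /T patchE; case: ifPn => xP.
    apply: tilt_gtilt_le => //.
    by move: xP; rewrite inE /P/= in_itv/= ler_norml.
  rewrite sub0r normrN; apply: gtilt_tail_le => //.
  move: xP; rewrite notin_setE /P/= in_itv/= -ler_norml => /negP; rewrite -ltNge.
  by move=> /ltW; apply: le_trans; apply: le_trans (pi_ge2 R); rewrite ler1n.
rewrite Rintegral_itvZ; last first.
  move=> x; apply: cvgV; first by rewrite lt0r_neq0// ltr_pwDl// mulr_ge0 ?sqr_ge0// ltW.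
  apply: cvgD; first exact: cvg_cst.
  by apply: cvgM; [exact: cvg_cst|exact: exprn_continuous].
rewrite ler_wpM2l ?divr_ge0 ?Ctilt_ge0 ?(ltW t0)//.
exact: Rintegral_cauchy_le.
Qed.

Lemma heat1_gauss1_le lam t n : 1 <= t -> t * lam ^+ 2 = 1 ->
  `|heat1 lam t n - gauss1 t n%:~R| <=
    Ctilt / (t * Num.sqrt t) * expR (- (lam * n%:~R)).
Proof.
move=> t1 tl; have t0 : 0 < t by apply: lt_le_trans t1.
have p0 := pi_gt0 R.
set c := (2 * pi)^-1 * expR (- (lam * n%:~R)).
have c0 : 0 <= c by rewrite mulr_ge0 ?expR_ge0// invr_ge0; lra.
have cv := @gtilt_cvg lam t n%:~R t0.
have cv2 : `|heat1 lam t n - c *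
    \int[mu]_(x in `[- m.+1%:R, m.+1%:R]) gtilt lam t n%:~R x| @[m --> \oo] -->
    `|heat1 lam t n - gauss1 t n%:~R|.
  by apply: cvg_norm; apply: cvgB; [exact: cvg_cst|exact: cv].
rewrite -(cvg_lim _ cv2)//; apply: limr_le; first by apply/cvg_ex; eexists; exact: cv2.
near=> m.
have pm : pi <= m.+1%:R :> R.
  have := pihalf_lt2 R => p4; apply: (@le_trans _ _ 4%:R); first by lra.
  by rewrite ler_nat; near: m; exists 4%N => // q /= ; lia.
rewrite /heat1 -/c -mulrBr normrM (ger0_norm c0).
apply: le_trans (ler_wpM2l c0 (Rintegral_tilt_gtilt_le n%:~R t1 tl pm)) _.
rewrite /c mulrAC ler_wpM2r ?expR_ge0//.
have s0 : 0 < Num.sqrt t by rewrite sqrtr_gt0.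
have -> : (2 * pi)^-1 * (Ctilt / t * (pi / Num.sqrt t)) = 2^-1 * (Ctilt / (t * Num.sqrt t)) * (pi / pi).
  by rewrite !invfM; ring.
rewrite divff ?lt0r_neq0// mulr1 ler_piMl ?invf_le1 ?ler1n//.
by rewrite divr_ge0 ?Ctilt_ge0// mulr_ge0 ?(ltW t0) ?(ltW s0).
Unshelve. all: by end_near. Qed.

(** The sign follows n, so that e^(- lam n) always decays, as e^(- |n| / sqrt t). *)
Definition tiltsgn t n : R := if (0 <= n)%R then (Num.sqrt t)^-1 else - (Num.sqrt t)^-1.

Lemma tiltsgn_mul t n : tiltsgn t n * n%:~R = `|n|%N%:R / Num.sqrt t.
Proof.
rewrite /tiltsgn; case: ifPn => [n0|]; first by rewrite mulrC natr_absz ger0_norm.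
by rewrite -ltNge => n0; rewrite mulNr -mulrN mulrC natr_absz ltr0_norm// mulrNz.
Qed.

Lemma tiltsgn_sqr t n : 0 < t -> t * tiltsgn t n ^+ 2 = 1.
Proof.
move=> t0; have -> : tiltsgn t n ^+ 2 = (Num.sqrt t) ^- 2.
  by rewrite /tiltsgn; case: ifP => _; rewrite ?sqrrN exprVn.
by rewrite sqr_sqrtr ?(ltW t0)// divff// lt0r_neq0.
Qed.

(** With u = |n| / sqrt t, the square (u / 2 - 1)^2 >= 0 gives u^2 / 4 >= u - 1. Trading Gaussian
    for exponential decay costs e <= 4. *)
Lemma gauss1_le t n : 0 < t ->
  `|gauss1 t n%:~R| <= 4 / Num.sqrt t * expR (- (`|n|%N%:R / Num.sqrt t)).
Proof.
move=> t0; have s0 : 0 < Num.sqrt t by rewrite sqrtr_gt0.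
have sp1 : 1 <= Num.sqrt pi :> R.
  by rewrite -sqrtr1 ler_wsqrtr//; apply: le_trans (pi_ge2 R); rewrite ler1n.
have sp0 : 0 < 2 * Num.sqrt pi * Num.sqrt t by rewrite !mulr_gt0// (lt_le_trans _ sp1).
rewrite /gauss1 normrM (ger0_norm (expR_ge0 _)) ger0_norm ?invr_ge0 ?(ltW sp0)//.
rewrite [4 / _]mulrC -[leRHS]mulrA; apply: ler_pM; rewrite ?expR_ge0 ?invr_ge0 ?(ltW sp0)//.
  by rewrite lef_pV2 ?posrE// ler_peMl ?(ltW s0)//; lra.
apply: (@le_trans _ _ (expR 1 * expR (- (`|n|%N%:R / Num.sqrt t)))); last first.
  by rewrite ler_wpM2r ?expR_ge0 ?expR1_le4.
rewrite -expRD ler_expR.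
have -> : (n%:~R : R) ^+ 2 / (4 * t) = (`|n|%N%:R / Num.sqrt t) ^+ 2 / 4.
  rewrite expr_div_n sqr_sqrtr ?(ltW t0)// natr_absz intr_norm real_normK ?num_real//.
  by rewrite invfM mulrA mulrAC.
have := sqr_ge0 ((`|n|%N%:R / Num.sqrt t) / 2 - 1); lra.
Qed.

(** The factors are exchanged one at a time; each exchange costs a relative error e with respect to
    the common bounds B w_i. *)
Lemma prod_dist_le m (a b w : 'I_m -> R) (B e : R) : 0 <= e -> 0 <= B ->
  (forall i, `|a i| <= B * w i) -> (forall i, `|b i| <= B * w i) ->
  (forall i, `|a i - b i| <= e * (B * w i)) ->
  `|\prod_i a i - \prod_i b i| <= m%:R * e * \prod_i (B * w i).
Proof.
move=> e0 B0; elim: m a b w => [|m IH] a b w ha hb hab.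
  by rewrite !big_ord0 subrr normr0 !mul0r.
rewrite !big_ord_recl.
set A := \prod_(i < m) a _; set A' := \prod_(i < m) b _; set P := \prod_(i < m) (B * _).
have hP : `|A'| <= P.
  by rewrite normr_prod; apply: ler_prod => i _; rewrite normr_ge0 hb.
have := IH _ _ _ (fun i => ha (lift ord0 i)) (fun i => hb (lift ord0 i)) (fun i => hab (lift ord0 i)).
rewrite -/A -/A' -/P => hI.
have -> : a ord0 * A - b ord0 * A' = a ord0 * (A - A') + (a ord0 - b ord0) * A' by ring.
apply: le_trans (ler_normD _ _) _; rewrite !normrM.
have h1 : `|a ord0| * `|A - A'| <= B * w ord0 * (m%:R * e * P) by apply: ler_pM.
have h2 : `|a ord0 - b ord0| * `|A'| <= e * (B * w ord0) * P by apply: ler_pM.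
apply: le_trans (lerD h1 h2) _; rewrite -natr1 le_eqVlt; apply/orP; left; apply/eqP; ring.
Qed.

(** * The local limit estimate in dimension d *)

Variable d : nat.
Notation pt := 'rV[int]_d.

Definition l1norm (z : pt) : nat := (\sum_(i < d) absz (z 0%R i))%N.
Definition gaussd t (z : pt) : R := \prod_(i < d) gauss1 t (z 0 i)%:~R.
(** Large enough for both one-dimensional kernels: 4 for the Gaussian, [Ctilt] for its distance to
    the lattice kernel. *)
Definition Clcl : R := 4 + Ctilt.

(** Each coordinate gets its own tilt sign, so the one-dimensional weights multiply to e^(- |z|_1 /
    sqrt t). Every factor is off by O(1 / t) relative to its bound, hence so is the product. *)
Lemma heat_gaussd_le t (z : pt) : 1 <= t ->
  `|heat t z - gaussd t z| <=
   d%:R * (1 + Ctilt) * Clcl ^+ d * (t^-1 * (Num.sqrt t) ^- d * expR (- ((l1norm z)%:R / Num.sqrt t))).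
Proof.
move=> t1; have t0 : 0 < t by apply: lt_le_trans t1.
have s1 : 1 <= Num.sqrt t by rewrite -sqrtr1 ler_wsqrtr.
have s0 : 0 < Num.sqrt t by rewrite sqrtr_gt0.
have C0 := Ctilt_ge0.
rewrite (@heat_prod R d (fun i => tiltsgn t (z 0 i)) t z (ltW t0)).
pose w (i : 'I_d) := expR (- ((absz (z 0 i))%:R / Num.sqrt t)).
have hd i : `|heat1 (tiltsgn t (z 0 i)) t (z 0 i) - gauss1 t (z 0 i)%:~R| <=
    Ctilt / (t * Num.sqrt t) * w i.
  by have := heat1_gauss1_le (z 0 i) t1 (tiltsgn_sqr (z 0 i) t0); rewrite tiltsgn_mul.
have hg i : `|gauss1 t (z 0 i)%:~R| <= Clcl / Num.sqrt t * w i.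
  apply: le_trans (gauss1_le _ t0) _; rewrite ler_wpM2r ?expR_ge0// ler_wpM2r ?invr_ge0 ?(ltW s0)//.
  by rewrite /Clcl lerDl.
have hh i : `|heat1 (tiltsgn t (z 0 i)) t (z 0 i)| <= Clcl / Num.sqrt t * w i.
  have -> : heat1 (tiltsgn t (z 0 i)) t (z 0 i) =
    (heat1 (tiltsgn t (z 0 i)) t (z 0 i) - gauss1 t (z 0 i)%:~R) + gauss1 t (z 0 i)%:~R by ring.
  apply: le_trans (ler_normD _ _) _; apply: le_trans (lerD (hd i) (gauss1_le _ t0)) _.
  have hle : Ctilt / (t * Num.sqrt t) + 4 / Num.sqrt t <= Clcl / Num.sqrt t.
    rewrite /Clcl [leRHS]mulrDl addrC lerD2l ler_wpM2l// lef_pV2 ?posrE ?mulr_gt0//.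
    by rewrite ler_peMl// (ltW s0).
  by rewrite -/(w i) -mulrDl ler_wpM2r ?expR_ge0.
have B0 : 0 <= Clcl / Num.sqrt t by rewrite divr_ge0 ?addr_ge0// ltW.
have e0 : 0 <= (1 + Ctilt) / t by rewrite divr_ge0 ?addr_ge0// ltW.
have hab i : `|heat1 (tiltsgn t (z 0 i)) t (z 0 i) - gauss1 t (z 0 i)%:~R| <=
    (1 + Ctilt) / t * (Clcl / Num.sqrt t * w i).
  apply: le_trans (hd i) _; rewrite !mulrA ler_wpM2r ?expR_ge0//.
  have -> : (1 + Ctilt) / t * Clcl / Num.sqrt t = (1 + Ctilt) * Clcl / (t * Num.sqrt t).
    by rewrite invfM; ring.
  rewrite ler_wpM2r ?invr_ge0 ?mulr_ge0 ?(ltW t0) ?(ltW s0)//.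
  rewrite /Clcl; nra.
apply: le_trans (prod_dist_le e0 B0 hh hg hab) _.
rewrite big_split/= prodr_const card_ord expr_div_n -expR_sum sumrN.
rewrite -mulr_suml -natr_sum -/(l1norm z).
by rewrite le_eqVlt; apply/orP; left; apply/eqP; ring.
Qed.

End local_limit.

(** * The Gamma function and the Riesz kernel *)

Section gamma.
Variable R : realType.
Notation mu := (@lebesgue_measure R).
Implicit Types (s t x p c a : R).

Lemma powRE x p : 0 < x -> x `^ p = expR (p * ln x).
Proof. by move=> x0; rewrite /powR gt_eqF. Qed.

Lemma in0yE x : (x \in (`]0, +oo[%classic : set R)) = (0 < x).
Proof.
by apply/idP/idP => [|x0]; rewrite inE/= in_itv/= andbT.
Qed.

Definition gamma_fun s t : R := t `^ (s - 1) * expR (- t).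

Lemma gamma_fun_ge0 s t : 0 <= gamma_fun s t.
Proof. by rewrite mulr_ge0 ?powR_ge0 ?expR_ge0. Qed.

Lemma continuous_gamma_fun s : {in `]0, +oo[%classic, continuous (gamma_fun s)}.
Proof.
move=> x; rewrite in0yE => x0; apply: cvgM; first exact: powR_continuous_pos.
by apply: (@is_derive_continuous _ (fun x => expR (- x)) (- expR (- x)));
  apply: is_derive_eq; rewrite /GRing.scale /=; ring.
Qed.

Lemma expRN_le_powRN x k : 0 < x -> expR (- x) <= k.+1%:R ^+ k.+1 * x `^ (- k.+1%:R).
Proof.
move=> x0; rewrite powRN powR_mulrn ?(ltW x0)// expRN ler_pdivlMr ?exprn_gt0//.
by rewrite mulrC ler_pdivrMr ?expR_gt0// expr_le_expR// ltW.
Qed.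

Lemma integrable_gamma_fun s : 0 < s -> mu.-integrable `]0, +oo[ (EFin \o gamma_fun s).
Proof.
(* The bound p <= s serves the end at 0; at infinity p <= 1 suffices once e^(- t) is replaced by
   t^(- k - 1) with k > s + 1. *)
move=> s0; set p := Num.min s 1.
have p0 : 0 < p by rewrite lt_min s0 ltr01.
have ps : p <= s by rewrite ge_min lexx.
have p1 : p <= 1 by rewrite ge_min lexx orbT.
have := archi_boundP (addr_ge0 (ltW s0) ler01); set k := Num.bound _ => hk.
have K0 : 0 <= k.+1%:R ^+ k.+1 :> R by rewrite exprn_ge0.
apply: (@integrable_powdom_le R p ((1 + k.+1%:R ^+ k.+1) * 4)) => //.
  exact: continuous_gamma_fun.
move=> x x0; rewrite ger0_norm ?gamma_fun_ge0// /gamma_fun.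
have w0 := powdom_ge0 p x.
have [x1|x1] := leP x 1.
  have h : x `^ (s - 1) <= 4 * powdom p x.
    by apply: powR_le_powdom_lt1 => //; rewrite ?x0//; lra.
  have e1 : expR (- x) <= 1 by rewrite expR_le1 oppr_le0 ltW.
  apply: (@le_trans _ _ (4 * powdom p x)).
    by apply: le_trans h; rewrite ler_piMr ?powR_ge0.
  have C1 : 1 <= 1 + k.+1%:R ^+ k.+1 :> R by rewrite lerDl.
  by rewrite -mulrA ler_peMl// mulr_ge0.
have h : x `^ (s - 1 - k.+1%:R) <= 4 * powdom p x.
  apply: powR_le_powdom_ge1 => //; first exact: ltW.
  by rewrite -natr1; lra.
apply: le_trans (ler_wpM2l (powR_ge0 _ _) (expRN_le_powRN k x0)) _.
rewrite mulrCA -powRD ?(lt0r_neq0 x0) ?implybT//.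
apply: le_trans (ler_wpM2l K0 h) _.
by rewrite -[leRHS]mulrA; apply: ler_wpM2r; [rewrite mulr_ge0|rewrite lerDr].
Qed.

(** On [1, 2] alone, t^(s - 1) >= 1 / t >= 1 / 2 and e^(- t) >= e^(-2), uniformly in s > 0. *)
Lemma Gamma_int_ge s : 0 < s -> expR (- 2) / 2 <= Gamma_int s.
Proof.
move=> s0; have int := integrable_gamma_fun s0.
have mI : measurable (`]0, +oo[%classic : set (measurableTypeR R)) by exact: measurable_itv.
have fin := integrable_fin_num mI int.
rewrite /Gamma_int /Rintegral -lee_fin fineK; last exact: fin.
have l12 : (1 : R) < 2 by rewrite ltr1n.
have e : (\int[mu]_(x in `[1%R, 2%R]) ((fun=> expR (- 2) / 2) x)%:E = (expR (- 2) / 2)%:E)%E.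
  have c0 x : 1 <= x <= 2 -> {for x, continuous (fun _ : R => expR (- 2) / 2 : R)}.
    by move=> _; exact: cvg_cst.
  have d0 x : 1 <= x <= 2 -> is_derive x 1 (fun y : R => y * (expR (- 2) / 2)) (expR (- 2) / 2).
    by move=> _; apply: is_derive_eq; rewrite /GRing.scale /=; ring.
  by rewrite (integral_itv_FTC l12 c0 d0); congr (_%:E); ring.
have sub : `[1, 2]%classic `<=` (`]0, +oo[%classic : set R).
  by move=> x /=; rewrite !in_itv/= andbT => /andP[x1 _]; apply: lt_le_trans x1.
have mg : measurable_fun (`]0, +oo[%classic : set (measurableTypeR R)) (EFin \o gamma_fun s).
  by case/integrableP : int.
rewrite -e; apply: (@le_trans _ _ (\int[mu]_(x in `[1%R, 2%R]) (x `^ (s - 1) * expR (- x))%:E)%E).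
  apply: ge0_le_integral => //.
  - exact: measurable_funS sub mg.
  - move=> x /=; rewrite in_itv/= => /andP[x1 x2]; rewrite lee_fin mulrC.
    have x0 : 0 < x by exact: lt_le_trans x1.
    apply: ler_pM; rewrite ?invr_ge0 ?expR_ge0//; last by rewrite ler_expR lerN2.
    apply: (@le_trans _ _ (x `^ (-1))).
      by rewrite powR_inv1 ?(ltW x0)// lef_pV2 ?posrE.
    by apply: ler_powR => //; lra.
apply: ge0_subset_integral => //.
by move=> x _; rewrite lee_fin; exact: gamma_fun_ge0.
Qed.

(** The source of uniformity in sigma. For 0 < sigma < 1 the extended Gamma function is Gamma(1 -
    sigma) / (- sigma), and dividing by sigma < 1 only increases its modulus. *)
Lemma inv_Gamma_le (sigma : R) : sigma < 1 -> sigma != 0 ->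
  `|Gamma (- sigma)|^-1 <= 2 * expR 2.
Proof.
move=> s1 sn0.
have h s : 0 < s -> (2 * expR 2)^-1 <= Gamma_int s.
  by move=> /Gamma_int_ge; rewrite expRN invfM mulrC.
have e0 : 0 < 2 * expR 2 :> R by rewrite mulr_gt0 ?expR_gt0.
suff hG : (2 * expR 2)^-1 <= `|Gamma (- sigma)|.
  have g0 : 0 < `|Gamma (- sigma)| by apply: lt_le_trans hG; rewrite invr_gt0.
  by rewrite -[leRHS]invrK lef_pV2 ?posrE// invr_gt0.
rewrite /Gamma; case: ifPn => sg.
  by apply: le_trans (h _ sg) _; exact: ler_norm.
have sp : 0 < sigma by rewrite lt0r sn0/= leNgt -oppr_gt0.
have q0 : 0 < - sigma + 1 by lra.
apply: le_trans (h _ q0) _; rewrite invrN mulrN normrN normrM.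
have g0 : 0 <= Gamma_int (- sigma + 1).
  by apply: le_trans (h _ q0); rewrite invr_ge0 ltW.
rewrite (ger0_norm g0) ler_peMr// ger0_norm ?invr_ge0 ?(ltW sp)//.
by rewrite invf_ge1// ltW.
Qed.

End gamma.

(** * The Riesz integral: convergence, Gaussian main term and error *)

Section riesz.
Variable R : realType.
Notation mu := (@lebesgue_measure R).
Variable d : nat.
Notation pt := 'rV[int]_d.
Implicit Types (t s r a x sigma : R) (z : pt).

Lemma enorm_sqr z : enorm R z ^+ 2 = \sum_(i < d) ((z 0 i)%:~R) ^+ 2.
Proof. by rewrite sqr_sqrtr// sumr_ge0// => i _; exact: sqr_ge0. Qed.

Lemma enorm_ge0 z : 0 <= enorm R z.
Proof. exact: sqrtr_ge0. Qed.

Lemma enorm_le_l1norm z : enorm R z <= (l1norm z)%:R.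
Proof.
rewrite -(@ler_pXn2r _ 2) ?nnegrE ?enorm_ge0// enorm_sqr /l1norm natr_sum.
have key n (f : 'I_n -> R) : (forall i, 0 <= f i) ->
    \sum_(i < n) f i ^+ 2 <= (\sum_(i < n) f i) ^+ 2.
  elim: n f => [|n IH] f f0; first by rewrite !big_ord0 expr0n.
  rewrite !big_ord_recl sqrrD.
  have := IH _ (fun i => f0 (lift ord0 i)).
  have h1 := f0 ord0; have h2 : 0 <= \sum_(i < n) f (lift ord0 i) by rewrite sumr_ge0.
  have := mulr_ge0 h1 h2; lra.
apply: le_trans (key _ _ _) => //.
apply: ler_sum => i _; rewrite natr_absz intr_norm real_normK ?num_real//.
Qed.

Lemma sqrt_expnN t : 0 < t -> (Num.sqrt t) ^- d = t `^ (- (d%:R / 2)).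
Proof.
move=> t0; rewrite powRN; congr (_^-1).
by rewrite -powR_mulrn ?sqrtr_ge0// -powR12_sqrt ?(ltW t0)// -powRrM mulrC.
Qed.

Lemma gaussdE t z : 0 < t -> gaussd t z =
  (4 * pi) `^ (- (d%:R / 2)) * t `^ (- (d%:R / 2)) * expR (- (enorm R z ^+ 2 / (4 * t))).
Proof.
move=> t0; rewrite /gaussd /gauss1 big_split/= prodr_const card_ord -expR_sum sumrN.
rewrite -mulr_suml -enorm_sqr; congr (_ * _).
have p4 : 0 < 4 * pi :> R by rewrite mulr_gt0// pi_gt0.
have -> : 2 * Num.sqrt pi = Num.sqrt (4 * pi) :> R.
  rewrite sqrtrM//; congr (_ * _); apply/esym.
  by rewrite (_ : 4 = 2 ^+ 2 :> R) ?sqrtr_sqr ?ger0_norm// -natrX.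
by rewrite -!sqrt_expnN// -invfM -exprMn exprVn.
Qed.

Lemma gaussd_ge0 t z : 0 < t -> 0 <= gaussd t z.
Proof. by move=> t0; rewrite gaussdE// !mulr_ge0 ?powR_ge0 ?expR_ge0. Qed.

Lemma gaussd_le t z : 0 < t ->
  gaussd t z <= t `^ (- (d%:R / 2)) * expR (- (enorm R z ^+ 2 / (4 * t))).
Proof.
move=> t0; rewrite gaussdE// ler_wpM2r ?expR_ge0// ler_piMl ?powR_ge0//.
rewrite -[leRHS](powRr0 (4 * pi)); apply: ler_powR.
  have := pi_ge2 R; lra.
by rewrite oppr_le0 divr_ge0.
Qed.

Lemma integral_gaussd sigma z : 0 < enorm R z -> 0 < d%:R / 2 + sigma ->
  (\int[mu]_(t in `]0%R, +oo[) (gaussd t z * t `^ (- 1 - sigma))%:E =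
   (4 `^ sigma * Gamma_int (d%:R / 2 + sigma) / pi `^ (d%:R / 2) *
    enorm R z `^ (- d%:R - 2 * sigma))%:E)%E.
Proof.
move=> r0 s0; set r := enorm R z in r0 *; set s := d%:R / 2 + sigma in s0 *.
pose c := r ^+ 2 / 4.
have c0 : 0 < c by rewrite divr_gt0// exprn_gt0.
have int := integrable_gamma_fun s0.
have mI : measurable (`]0, +oo[%classic : set (measurableTypeR R)) by exact: measurable_itv.
have fin := integrable_fin_num mI int.
have GE : (\int[mu]_(x in `]0%R, +oo[) (gamma_fun s x)%:E = (Gamma_int s)%:E)%E.
  by rewrite /Gamma_int /Rintegral fineK.
pose K := (4 * pi) `^ (- (d%:R / 2)) * c `^ (- s).
have K0 : 0 <= K by rewrite mulr_ge0 ?powR_ge0.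
have p0 := pi_gt0 R.
have e x : 0 < x -> gaussd x z * x `^ (- 1 - sigma) = K * (gamma_fun s (c / x) * (c / x ^+ 2)).
  move=> x0; rewrite gaussdE// -/r /gamma_fun /K /c.
  have cx : 0 < r ^+ 2 / 4 / x by rewrite divr_gt0.
  have -> : r ^+ 2 / (4 * x) = r ^+ 2 / 4 / x by rewrite invfM mulrA.
  (* All powers are turned into exponentials of logarithms, which reduces the identity to one
     between exponents. *)
  have cx2 : r ^+ 2 / 4 / x ^+ 2 = expR (ln (r ^+ 2 / 4) - 2 * ln x).
    rewrite expRD expRN lnK// mulrC [2 * _]mulrC expRM_natr lnK ?posrE// mulrC//.
  have p4 : 0 < 4 * pi :> R by rewrite mulr_gt0.
  have rc : 0 < r ^+ 2 / 4 by exact: c0.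
  have lnx : ln (r ^+ 2 / 4 / x) = ln (r ^+ 2 / 4) - ln x by rewrite ln_div ?posrE.
  rewrite cx2 !powRE// lnx.
  move: (expR (- (r ^+ 2 / 4 / x))) (ln (r ^+ 2 / 4)) => E l.
  have -> : expR (- (d%:R / 2) * ln (4 * pi)) * expR (- (d%:R / 2) * ln x) * E *
    expR ((-1 - sigma) * ln x) = expR (- (d%:R / 2) * ln (4 * pi)) *
    (expR (- (d%:R / 2) * ln x) * expR ((-1 - sigma) * ln x)) * E by ring.
  have -> : expR (- (d%:R / 2) * ln (4 * pi)) * expR (- s * l) *
    (expR ((s - 1) * (l - ln x)) * E * expR (l - 2 * ln x)) =
    expR (- (d%:R / 2) * ln (4 * pi)) * (expR (- s * l) *
    expR ((s - 1) * (l - ln x)) * expR (l - 2 * ln x)) * E by ring.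
  congr (_ * _ * _); rewrite -!expRD; congr expR; rewrite /s; ring.
have -> : (\int[mu]_(t in `]0%R, +oo[) (gaussd t z * t `^ (- 1 - sigma))%:E =
    \int[mu]_(t in `]0%R, +oo[) (K%:E * (gamma_fun s (c / t) * (c / t ^+ 2))%:E))%E.
  by apply: eq_integral => x; rewrite in0yE => x0; rewrite e// EFinM.
have cgam := @continuous_gamma_fun R s.
have csub : {in `]0, +oo[%classic, continuous (fun t => gamma_fun s (c / t) * (c / t ^+ 2))}.
  move=> x; rewrite in0yE => x0; have xn0 := lt0r_neq0 x0.
  apply: cvgM.
    apply: (@continuous_comp _ _ _ (fun x => c / x) (gamma_fun s)).
      by apply: cvgM; [exact: cvg_cst|apply: cvgV => //; exact: cvg_id].
    by apply: cgam; rewrite in0yE divr_gt0.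
  apply: cvgM; first exact: cvg_cst.
  by apply: cvgV; [rewrite expf_neq0|exact: exprn_continuous].
rewrite ge0_integralZl//; last 2 first.
- by apply/measurable_EFinP; exact: open_continuous_measurable_fun.
- move=> x; rewrite /= in_itv/= andbT => x0; rewrite lee_fin mulr_ge0 ?gamma_fun_ge0//.
  by rewrite divr_ge0 ?(ltW c0) ?sqr_ge0.
rewrite -(integral0y_inv_subst c0 cgam (fun x _ => gamma_fun_ge0 s x)) GE -EFinM.
congr (_%:E).
have -> : 4 `^ sigma * Gamma_int s / pi `^ (d%:R / 2) * r `^ (- d%:R - 2 * sigma) =
    4 `^ sigma / pi `^ (d%:R / 2) * r `^ (- d%:R - 2 * sigma) * Gamma_int s by ring.
congr (_ * _); rewrite /K -powRN.
have p4 : 0 < 4 * pi :> R by rewrite mulr_gt0.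
have r2 : 0 < r ^+ 2 by rewrite exprn_gt0.
have lnc : ln c = ln r *+ 2 - ln 4 by rewrite /c ln_div ?posrE// lnXn.
have ln4p : ln (4 * pi) = ln 4 + ln pi :> R by rewrite lnM ?posrE.
rewrite !powRE// lnc ln4p.
by rewrite -!expRD; congr expR; rewrite /s -mulr_natl; field.
Qed.

Lemma integrable_gaussd sigma z : 0 < enorm R z -> 0 < d%:R / 2 + sigma ->
  mu.-integrable `]0, +oo[ (EFin \o (fun t => gaussd t z * t `^ (- 1 - sigma))).
Proof.
move=> r0 s0.
have ex x : 0 < x -> is_derive x 1 (fun t : R => - (enorm R z ^+ 2 / (4 * t))) (enorm R z ^+ 2 / (4 * x ^+ 2)).
  move=> x0; have xn0 := lt0r_neq0 x0.
  have hh : is_derive x 1 (fun y : R => (4 * y)^-1) (- (4 * x) ^- 2 *: (4 * 1 + x * 0)).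
    apply: is_deriveV; first by rewrite mulf_neq0.
    by apply: is_derive_eq; rewrite /GRing.scale /=; ring.
  by apply: is_derive_eq; rewrite /GRing.scale /=; field.
have cg : {in `]0, +oo[%classic, continuous (fun t : R => ((4 * pi) `^ (- (d%:R / 2)) *
   t `^ (- (d%:R / 2)) * expR (- (enorm R z ^+ 2 / (4 * t)))) * t `^ (- 1 - sigma))}.
  move=> x; rewrite in0yE => x0.
  apply: cvgM; last exact: powR_continuous_pos.
  apply: cvgM; first by apply: cvgM; [exact: cvg_cst|exact: powR_continuous_pos].
  apply: (@continuous_comp _ _ _ (fun t : R => - (enorm R z ^+ 2 / (4 * t))) expR).
    exact: is_derive_continuous (ex _ x0).
  exact: continuous_expR.
apply/integrableP; split.
  apply: (@eq_measurable_fun _ _ _ _ _ (EFin \o (fun t : R => ((4 * pi) `^ (- (d%:R / 2)) *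
   t `^ (- (d%:R / 2)) * expR (- (enorm R z ^+ 2 / (4 * t)))) * t `^ (- 1 - sigma)))).
    by move=> x; rewrite in0yE => x0 /=; rewrite gaussdE.
  by apply/measurable_EFinP; exact: open_continuous_measurable_fun.
rewrite (_ : (\int[mu]_(x in _) _)%E =
  (\int[mu]_(t in `]0%R, +oo[) (gaussd t z * t `^ (- 1 - sigma))%:E)%E).
  by rewrite integral_gaussd// ltry.
apply: eq_integral => x; rewrite in0yE => x0 /=.
by rewrite ger0_norm// mulr_ge0 ?powR_ge0 ?gaussd_ge0.
Qed.

(* The tilt [lam = sgn(n) ln (4 / t)] turns the exponential weight into [(t/4)^|n|]. *)
Lemma heat_small_time t z : 0 < t <= 1 ->
  `|heat t z| <= expR (8 * d%:R) * (t / 4) ^+ l1norm z.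
Proof.
move=> /andP[t0 t1].
pose l := ln (4 / t).
have t4 : 0 < 4 / t by rewrite divr_gt0.
pose lam (n : int) := if (0 <= n)%R then l else - l.
have lamn (n : int) : lam n * n%:~R = l * `|n|%N%:R.
  rewrite /lam natr_absz; case: ifPn => [n0|]; first by rewrite ger0_norm.
  by rewrite -ltNge => n0; rewrite ltr0_norm// mulrNz mulNr mulrN.
have cl (n : int) : 2 * t * (cosh (lam n) - 1) <= 8.
  have -> : cosh (lam n) = (4 / t + t / 4) / 2.
    have e1 : expR l = 4 / t by rewrite /l lnK.
    have e2 : expR (- l) = t / 4 by rewrite expRN e1 invf_div.
    by rewrite /cosh /lam; case: ifP => _; rewrite ?opprK e1 e2// addrC.
  have -> : 2 * t * ((4 / t + t / 4) / 2 - 1) = 4 + t ^+ 2 / 4 - 2 * t.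
    by field; rewrite lt0r_neq0.
  nra.
rewrite (@heat_prod R d (fun i => lam (z 0 i)) t z (ltW t0)) normr_prod.
have -> : expR (8 * d%:R) * (t / 4) ^+ l1norm z =
    \prod_(i < d) (expR 8 * (t / 4) ^+ absz (z 0 i)).
  rewrite big_split/= prodr_const card_ord -expRM_natr; congr (_ * _).
  by rewrite /l1norm; elim/big_rec2 : _ => [|i y1 y2 _ <-]; rewrite ?expr0// exprD.
apply: ler_prod => i _; rewrite normr_ge0/=.
apply: le_trans (heat1_le _ _ (ltW t0)) _; apply: ler_pM; rewrite ?expR_ge0 ?ler_expR//.
by rewrite lamn expRN expRM_natr /l lnK ?posrE// -exprVn invf_div.
Qed.

(** The untilted product formula, equal to [heat] for t >= 0. It is visibly differentiable in t,
    unlike the pointwise limit defining [heat], and so provides continuity and measurability. *)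
Definition heatprod z t : R := \prod_(i < d) heat1 0 t (z 0 i).

Lemma heatprodE z t : 0 <= t -> heat t z = heatprod z t.
Proof. by move=> t0; rewrite (@heat_prod R d (fun=> 0) t z t0). Qed.

Lemma continuous_heatprod z : continuous (heatprod z).
Proof.
move=> t; have := @is_derive_prod R d (fun i t => heat1 0 t (z 0 i)) _ t
  (fun i => is_derive_heat1 0 t (z 0 i)).
exact: is_derive_continuous.
Qed.

Definition Cheat : R := d%:R * (1 + Ctilt R) * Clcl R ^+ d.

Lemma Cheat_ge0 : 0 <= Cheat.
Proof.
have C0 := Ctilt_ge0 R.
by rewrite /Cheat !mulr_ge0 ?exprn_ge0 ?addr_ge0.
Qed.

Lemma heatprod_large_time z t : 1 <= t ->
  `|heatprod z t| <= (1 + Cheat) * t `^ (- (d%:R / 2)).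
Proof.
move=> t1; have t0 : 0 < t by exact: lt_le_trans t1.
have -> : heatprod z t = gaussd t z + (heatprod z t - gaussd t z) by ring.
apply: le_trans (ler_normD _ _) _; rewrite mulrDl mul1r; apply: lerD.
  rewrite ger0_norm ?gaussd_ge0//; apply: le_trans (gaussd_le z t0) _.
  rewrite ler_piMr ?powR_ge0// expR_le1 oppr_le0 divr_ge0 ?sqr_ge0// mulr_ge0// ltW//.
rewrite -heatprodE ?(ltW t0)//; apply: le_trans (heat_gaussd_le z t1) _.
rewrite -/Cheat ler_wpM2l ?Cheat_ge0// sqrt_expnN// mulrAC ler_piMl ?powR_ge0//.
rewrite mulr_ile1 ?invr_ge0 ?expR_ge0 ?(ltW t0)//.
  by rewrite invf_le1.
Qed.

(** Near 0 the kernel is O(t^k), with k = 0 enough for sigma < 0, and k = 1 <= |z|_1 available for z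
    != 0 and enough for sigma < 1. At infinity t^(- d / 2) suffices because d / 2 + sigma > 0. *)
Lemma integrable_heatprod sigma z : - (d%:R / 2) < sigma -> sigma < 1 ->
  sigma < 0 \/ z != 0 ->
  mu.-integrable `]0, +oo[ (EFin \o (fun t => heatprod z t * t `^ (- 1 - sigma))).
Proof.
move=> sd s1 sz.
have [k [ks kz]] : exists k : nat, sigma < k%:R /\ (k <= l1norm z)%N.
  case: sz => [s0|z0]; first by exists 0%N.
  exists 1%N; split => //; rewrite lt0n; apply: contra z0 => /eqP h.
  apply/eqP/rowP => i; rewrite mxE; apply/eqP.
  have : (absz (z 0%R i) <= l1norm z)%N by rewrite /l1norm (bigD1 i)//= leq_addr.
  by rewrite h leqn0 absz_eq0.
set p := Num.min (k%:R - sigma) (d%:R / 2 + sigma).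
have p0 : 0 < p by rewrite lt_min; apply/andP; split; lra.
have pk : p <= k%:R - sigma by rewrite ge_min lexx.
have pd : p <= d%:R / 2 + sigma by rewrite ge_min lexx orbT.
have E0 : 0 <= expR (8 * d%:R) :> R by exact: expR_ge0.
have C0 : 0 <= 1 + Cheat by rewrite addr_ge0 ?Cheat_ge0.
apply: (@integrable_powdom_le R p ((expR (8 * d%:R) + (1 + Cheat)) * 4)) => //.
  move=> x; rewrite in0yE => x0; apply: cvgM; first exact: continuous_heatprod.
  exact: powR_continuous_pos.
move=> x x0; rewrite normrM (ger0_norm (powR_ge0 _ _)).
have w0 := powdom_ge0 p x.
have [x1|x1] := leP x 1.
  have h : x `^ (k%:R + (- 1 - sigma)) <= 4 * powdom p x.
    by apply: powR_le_powdom_lt1 => //; rewrite ?x0//; lra.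
  apply: (@le_trans _ _ (expR (8 * d%:R) * (4 * powdom p x))); last first.
    by rewrite -[leRHS]mulrA; apply: ler_wpM2r; [rewrite mulr_ge0|rewrite lerDl].
  apply: le_trans (ler_wpM2l E0 h).
  rewrite [x `^ (k%:R + _)]powRD ?(lt0r_neq0 x0) ?implybT// mulrA ler_wpM2r ?powR_ge0//.
  rewrite -heatprodE ?(ltW x0)//; apply: le_trans (@heat_small_time x z _) _; first by rewrite x0.
  rewrite ler_wpM2l// powR_mulrn ?(ltW x0)//.
  apply: (@le_trans _ _ (x ^+ l1norm z)).
    rewrite lerXn2r ?nnegrE ?divr_ge0 ?(ltW x0)// ler_pdivrMr//; lra.
  by rewrite ler_wiXn2l ?(ltW x0).
have x1' := ltW x1.
have h : x `^ (- (d%:R / 2) + (- 1 - sigma)) <= 4 * powdom p x.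
  by apply: powR_le_powdom_ge1 => //; lra.
apply: (@le_trans _ _ ((1 + Cheat) * (4 * powdom p x))); last first.
  by rewrite -[leRHS]mulrA; apply: ler_wpM2r; [rewrite mulr_ge0|rewrite lerDr].
apply: le_trans (ler_wpM2l C0 h).
rewrite [x `^ (- (d%:R / 2) + _)]powRD ?(lt0r_neq0 x0) ?implybT// mulrA ler_wpM2r ?powR_ge0//.
exact: heatprod_large_time.
Qed.

(** Chosen so that the exponent K - d / 2 - 2 - sigma is positive for every sigma < 1. It also
    serves as the radius beyond which the estimate holds, since |z| >= K gives t^|z|_1 <= t^K for t
    <= 1. [Cpol] uses 2 K because e^(- r / sqrt t) has to yield (sqrt t / r)^(2 K). *)
Let K : nat := d.+3.
Definition Cpol : R := (K.*2)%:R ^+ K.*2.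
Definition Cgau : R := (4 * K%:R) ^+ K.
Definition Cdif : R := expR (8 * d%:R) * Cpol + Cgau + Cheat * (Cpol + 1).

Lemma expRN_div_le r t : 0 < r -> 0 < t ->
  expR (- (r / Num.sqrt t)) <= Cpol * (t / r ^+ 2) ^+ K.
Proof.
move=> r0 t0; have s0 : 0 < Num.sqrt t by rewrite sqrtr_gt0.
have := @expRN_le_powRN R (r / Num.sqrt t) (K.*2.-1).
have -> : (K.*2.-1).+1 = K.*2 by rewrite /K.
rewrite divr_gt0// => /(_ isT) h; apply: le_trans h _.
rewrite /Cpol ler_wpM2l ?exprn_ge0// powRN powR_mulrn ?divr_ge0 ?(ltW r0) ?(ltW s0)//.
by rewrite -exprVn invf_div -mul2n exprM expr_div_n sqr_sqrtr// ltW.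
Qed.

(** For t <= 1 the kernels are not compared: each is at most a multiple of (t / |z|^2)^K, and t^(- d
    / 2 - 1) >= 1 comes for free. For t > 1 the exponential in the local limit estimate is weakened
    to the same power. *)
Lemma heatprod_gaussd_le z t : K%:R <= enorm R z -> 0 < t ->
  `|heatprod z t - gaussd t z| <=
    Cdif * (t `^ (- (d%:R / 2) - 1) * (t / enorm R z ^+ 2) ^+ K).
Proof.
set r := enorm R z => rK t0.
have r0 : 0 < r by apply: lt_le_trans rK; rewrite ltr0n.
have a0 : 0 < r ^+ 2 by rewrite exprn_gt0.
have rl : r <= (l1norm z)%:R := enorm_le_l1norm z.
have P0 : 0 <= (t / r ^+ 2) ^+ K by rewrite exprn_ge0// divr_ge0// ltW.
have Cp : 0 <= Cpol by rewrite exprn_ge0.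
have Cg : 0 <= Cgau by rewrite exprn_ge0// mulr_ge0.
have Ch := Cheat_ge0.
have E0 : 0 <= expR (8 * d%:R) :> R by exact: expR_ge0.
have T0 : 0 <= t `^ (- (d%:R / 2) - 1) by exact: powR_ge0.
have Q0 := mulr_ge0 T0 P0.
have [t1|t1] := leP t 1.
  apply: (@le_trans _ _ ((expR (8 * d%:R) * Cpol + Cgau) *
      (t `^ (- (d%:R / 2) - 1) * (t / r ^+ 2) ^+ K))); last first.
    by rewrite ler_wpM2r// /Cdif lerDl mulr_ge0// addr_ge0.
  apply: le_trans (ler_normB _ _) _; rewrite mulrDl; apply: lerD.
    rewrite -heatprodE ?(ltW t0)//; apply: le_trans (@heat_small_time t z _) _; first by rewrite t0.
    rewrite -mulrA ler_wpM2l//.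
    (* Here the 4 in the tilt ln (4 / t) pays off: 4^(- |z|_1) <= e^(- |z|) gives decay in |z| even
       at t = 1, where powers of t give none. *)
    have h4 : (4^-1 : R) ^+ l1norm z <= Cpol * (1 / r ^+ 2) ^+ K.
      apply: le_trans (expRN_div_le r0 ltr01); rewrite sqrtr1 divr1.
      apply: (@le_trans _ _ (expR (- (l1norm z)%:R))); last by rewrite ler_expR lerN2.
      rewrite -[(l1norm z)%:R]mul1r expRN expRM_natr -exprVn lerXn2r ?nnegrE ?invr_ge0 ?expR_ge0//.
      by rewrite lef_pV2 ?posrE ?expR_gt0// expR1_le4.
    have hk : (K <= l1norm z)%N by rewrite -(ler_nat R); exact: le_trans rl.
    rewrite exprMn; apply: (@le_trans _ _ (t ^+ K * (Cpol * (1 / r ^+ 2) ^+ K))).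
      apply: ler_pM; rewrite ?exprn_ge0 ?(ltW t0)//.
      by rewrite ler_wiXn2l ?(ltW t0).
    rewrite expr_div_n expr1n mul1r [(t / _) ^+ _]expr_div_n.
    rewrite mulrCA ler_wpM2l// [t `^ _ * _]mulrA ler_wpM2r ?invr_ge0 ?exprn_ge0 ?(ltW r0)//.
    rewrite ler_peMl ?exprn_ge0 ?(ltW t0)//.
    apply: (@le_trans _ _ (t `^ 0)); first by rewrite powRr0.
    apply: ger_powR; first by rewrite t0.
    by rewrite -opprD oppr_le0 addr_ge0// divr_ge0.
  rewrite ger0_norm ?gaussd_ge0//; apply: le_trans (gaussd_le z t0) _.
  rewrite -/r mulrCA; apply: ler_pM; rewrite ?powR_ge0 ?expR_ge0//.
    apply: ger_powR; first by rewrite t0.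
    by rewrite gerDl lerN10.
  have x0 : 0 < r ^+ 2 / (4 * t) by rewrite divr_gt0// mulr_gt0.
  have := expRN_le_powRN d.+2 x0; rewrite -/K => h; apply: le_trans h _.
  rewrite powRN powR_mulrn ?(ltW x0)// -exprVn invf_div /Cgau -exprMn -exprMn.
  rewrite le_eqVlt; apply/orP; left; apply/eqP; congr (_ ^+ _); ring.
apply: (@le_trans _ _ (Cheat * Cpol * (t `^ (- (d%:R / 2) - 1) * (t / r ^+ 2) ^+ K))); last first.
  rewrite ler_wpM2r// /Cdif mulrDr mulr1 -[leLHS]add0r addrA.
  by rewrite -[leLHS]addr0 lerD// lerD2r addr_ge0// mulr_ge0.
rewrite -heatprodE ?(ltW t0)//; apply: le_trans (heat_gaussd_le z (ltW t1)) _.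
rewrite -/Cheat -[leRHS]mulrA ler_wpM2l// sqrt_expnN//.
have -> : t^-1 * t `^ (- (d%:R / 2)) = t `^ (- (d%:R / 2) - 1).
  by rewrite powRD ?(lt0r_neq0 t0) ?implybT// powR_inv1 ?(ltW t0)// mulrC.
rewrite mulrCA ler_wpM2l//; apply: le_trans (expRN_div_le r0 t0).
by rewrite ler_expR lerN2 ler_wpM2r ?invr_ge0 ?sqrtr_ge0.
Qed.

Lemma Cheat_le_Cdif : Cheat <= Cdif.
Proof.
have Cp : 0 <= Cpol by rewrite exprn_ge0.
have Cg : 0 <= Cgau by rewrite exprn_ge0// mulr_ge0.
have h1 : 0 <= expR (8 * d%:R) * Cpol by rewrite mulr_ge0 ?expR_ge0.
have h2 := mulr_ge0 Cheat_ge0 Cp.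
rewrite /Cdif mulrDr mulr1 addrA lerDr.
by apply: addr_ge0 => //; apply: addr_ge0.
Qed.

Lemma Cdif_ge0 : 0 <= Cdif.
Proof. exact: le_trans Cheat_ge0 Cheat_le_Cdif. Qed.

Lemma heatprod_gaussd_le_large z t : 1 <= t ->
  `|heatprod z t - gaussd t z| <= Cdif * t `^ (- (d%:R / 2) - 1).
Proof.
move=> t1; have t0 : 0 < t by exact: lt_le_trans t1.
rewrite -heatprodE ?(ltW t0)//; apply: le_trans (heat_gaussd_le z t1) _.
rewrite -/Cheat sqrt_expnN//.
have -> : t^-1 * t `^ (- (d%:R / 2)) = t `^ (- (d%:R / 2) - 1).
  by rewrite powRD ?(lt0r_neq0 t0) ?implybT// powR_inv1 ?(ltW t0)// mulrC.
apply: ler_pM; [exact: Cheat_ge0| |exact: Cheat_le_Cdif|].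
  by rewrite mulr_ge0 ?powR_ge0 ?expR_ge0.
by rewrite ler_piMr ?powR_ge0// expR_le1 oppr_le0 divr_ge0// sqrtr_ge0.
Qed.

(** The split is at t = a = |z|^2. Below it the factor (t / a)^K makes the bound increase with t, so
    its value at t = a is used; above it, t^(- d / 2 - sigma) <= a^(- d / 2 - sigma). The 4 comes
    from a + t being at most twice the larger of a and t. *)
Lemma riesz_integrand_le sigma z t : - (d%:R / 2) < sigma -> sigma < 1 ->
  K%:R <= enorm R z -> 0 < t ->
  `|(heatprod z t - gaussd t z) * t `^ (- 1 - sigma)| <=
   4 * Cdif * (enorm R z ^+ 2) `^ (- (d%:R / 2) - 1 - sigma) *
   (enorm R z ^+ 2 / (enorm R z ^+ 2 + t) ^+ 2).
Proof.
move=> sd s1 rK t0; have hs := heatprod_gaussd_le rK t0.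
set a := enorm R z ^+ 2 in hs *.
have K1 : (1 : R) <= K%:R by rewrite ler1n.
have a1 : 1 <= a by rewrite /a exprn_ege1// (le_trans K1).
have a0 : 0 < a by exact: lt_le_trans a1.
have C0 := Cdif_ge0.
have at0 : 0 < a + t by rewrite addr_gt0.
have tn0 : t != 0 by rewrite lt0r_neq0.
have an0 : a != 0 by rewrite lt0r_neq0.
rewrite normrM (ger0_norm (powR_ge0 _ _)).
have -> : 4 * Cdif * a `^ (- (d%:R / 2) - 1 - sigma) * (a / (a + t) ^+ 2) =
  Cdif * (a `^ (- (d%:R / 2) - 1 - sigma) * (4 * a / (a + t) ^+ 2)) by ring.
have [ta|ta] := ltP t a.
  apply: le_trans (ler_wpM2r (powR_ge0 _ _) hs) _.
  rewrite -[leLHS]mulrA ler_wpM2l//.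
  have -> : t `^ (- (d%:R / 2) - 1) * (t / a) ^+ K * t `^ (-1 - sigma) =
     t `^ (K%:R - d%:R / 2 - 2 - sigma) * a `^ (- K%:R).
    rewrite expr_div_n -!powR_mulrn ?(ltW t0) ?(ltW a0)// powRN.
    rewrite mulrA mulrAC; congr (_ * _); rewrite -!powRD ?tn0 ?implybT//.
    by congr (t `^ _); ring.
  have h1 : t `^ (K%:R - d%:R / 2 - 2 - sigma) <= a `^ (K%:R - d%:R / 2 - 2 - sigma).
    apply: ge0_ler_powR; rewrite ?nnegrE ?(ltW t0) ?(ltW a0) ?(ltW ta)//.
    have -> : K%:R = d%:R + 3 :> R by rewrite /K -addn3 natrD.
    by have : 0 <= d%:R :> R by []; lra.
  apply: (@le_trans _ _ (a `^ (- (d%:R / 2) - 1 - sigma) * a `^ (-1))).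
    apply: le_trans (ler_wpM2r (powR_ge0 _ _) h1) _.
    by rewrite -!powRD ?an0 ?implybT// le_eqVlt; apply/orP; left; apply/eqP; congr (a `^ _); ring.
  rewrite ler_wpM2l ?powR_ge0// powR_inv1 ?(ltW a0)// ler_pdivlMr ?exprn_gt0//.
  rewrite mulrC ler_pdivrMr//; nra.
have t1 : 1 <= t by exact: le_trans ta.
apply: le_trans (ler_wpM2r (powR_ge0 _ _) (heatprod_gaussd_le_large z t1)) _.
rewrite -[leLHS]mulrA ler_wpM2l//.
have -> : t `^ (- (d%:R / 2) - 1) * t `^ (-1 - sigma) = t `^ (- (d%:R / 2 + sigma)) * t ^- 2.
  rewrite -powR_invn ?(ltW t0)// -!powRD ?tn0 ?implybT//; congr (t `^ _); ring.
have -> : a `^ (- (d%:R / 2) - 1 - sigma) = a `^ (- (d%:R / 2 + sigma)) * a^-1.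
  rewrite -(powR_inv1 (ltW a0)) -!powRD ?an0 ?implybT//; congr (a `^ _); ring.
rewrite -[leRHS]mulrA; apply: ler_pM; rewrite ?powR_ge0 ?invr_ge0 ?sqr_ge0//.
  rewrite !powRN lef_pV2 ?posrE ?powR_gt0//; apply: ge0_ler_powR; rewrite ?nnegrE ?(ltW t0) ?(ltW a0)//.
  lra.
have -> : a^-1 * (4 * a / (a + t) ^+ 2) = 4 / (a + t) ^+ 2.
  by rewrite mulrA mulrCA mulVf// mulr1.
rewrite ler_pdivlMr ?exprn_gt0// mulrC ler_pdivrMr ?exprn_gt0//; nra.
Qed.

Lemma kappaE sigma z : - (d%:R / 2) < sigma -> sigma < 1 -> sigma < 0 \/ z != 0 ->
  kappa sigma z = (`|Gamma (- sigma)|^-1 *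
    \int[mu]_(t in `]0%R, +oo[) (heatprod z t * t `^ (- 1 - sigma)))%:E.
Proof.
move=> sd s1 sz; rewrite /kappa.
have -> : (0 < sigma < 1) && (z == 0) = false.
  by case: sz => [s0|/negbTE ->]; [rewrite ltNge (ltW s0)|rewrite andbF].
have mI : measurable (`]0, +oo[%classic : set (measurableTypeR R)) by exact: measurable_itv.
have fin := integrable_fin_num mI (integrable_heatprod sd s1 sz).
rewrite EFinM /Rintegral fineK; last exact: fin.
congr (_ * _)%E; apply: eq_integral => t; rewrite in0yE => t0.
by rewrite heatprodE// ltW.
Qed.

(** The main term is exactly the Riesz integral of the Gaussian kernel, so the error is a single
    integral of the difference. The divergence of Gamma(d/2 + sigma) as sigma tends to - d / 2 sits
    in the main term and never enters the constant. *)
Lemma riesz_kernel_asymptotics sigma z : - (d%:R / 2) < sigma -> sigma < 1 -> sigma != 0 ->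
  K%:R <= enorm R z ->
  `| fine (kappa sigma z) - Cconst d sigma * enorm R z `^ (- d%:R - 2 * sigma) |
     <= 2 * expR 2 * (4 * Cdif) * enorm R z `^ (- d%:R - 2 * sigma - 2).
Proof.
move=> sd s1 sn0 rK.
have r0 : 0 < enorm R z by apply: lt_le_trans rK; rewrite ltr0n.
have a0 : 0 < enorm R z ^+ 2 by rewrite exprn_gt0.
have z0 : z != 0.
  apply/eqP => ze; move: r0; rewrite ze /enorm big1 ?sqrtr0 ?ltxx// => i _.
  by rewrite mxE expr0n.
have s0 : 0 < d%:R / 2 + sigma by lra.
have iH := integrable_heatprod sd s1 (or_intror z0).
have iG := integrable_gaussd r0 s0.
have mI : measurable (`]0, +oo[%classic : set (measurableTypeR R)) by exact: measurable_itv.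
rewrite (kappaE sd s1 (or_intror z0)) /=.
have -> : Cconst d sigma * enorm R z `^ (- d%:R - 2 * sigma) = `|Gamma (- sigma)|^-1 *
    \int[mu]_(t in `]0%R, +oo[) (gaussd t z * t `^ (- 1 - sigma)).
  (* Positivity of d / 2 + sigma selects the integral branch of [Gamma] there; the other occurrence,
     at - sigma, is folded back. *)
  rewrite /Rintegral integral_gaussd//= /Cconst /Gamma s0 -/(Gamma (- sigma)).
  by rewrite [RHS]mulrC invfM; ring.
rewrite -mulrBr normrM ger0_norm ?invr_ge0//.
have -> : 2 * expR 2 * (4 * Cdif) * enorm R z `^ (- d%:R - 2 * sigma - 2) =
  (2 * expR 2) * (4 * Cdif * (enorm R z ^+ 2) `^ (- (d%:R / 2) - 1 - sigma)).
  rewrite -[LHS]mulrA; congr (_ * (_ * _)).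
  by rewrite !powRE// lnXn//; congr expR; rewrite -mulr_natl; field.
apply: ler_pM; rewrite ?invr_ge0 ?inv_Gamma_le//.
rewrite -RintegralB//.
set B := 4 * Cdif * _.
have B0 : 0 <= B by rewrite !mulr_ge0 ?Cdif_ge0 ?powR_ge0.
have iD : mu.-integrable `]0, +oo[ (EFin \o (fun t =>
    heatprod z t * t `^ (- 1 - sigma) - gaussd t z * t `^ (- 1 - sigma))).
  by have := integrableB mI iH iG.
apply: le_trans (le_normr_Rintegral mI iD) _.
have iN := integrable_norm iD.
have fin := integrable_fin_num mI iN.
rewrite /Rintegral -lee_fin fineK; last exact: fin.
pose h (t : R) := enorm R z ^+ 2 / (enorm R z ^+ 2 + t) ^+ 2.
have ch : {in `]0, +oo[%classic, continuous h}.
  move=> x; rewrite in0yE => x0; apply: cvgM; first exact: cvg_cst.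
  apply: cvgV; first by rewrite expf_neq0// lt0r_neq0// addr_gt0.
  apply: (@continuous_comp _ _ _ (fun x => enorm R z ^+ 2 + x) (fun x => x ^+ 2)).
    by apply: cvgD; [exact: cvg_cst|exact: cvg_id].
  exact: exprn_continuous.
have mh : measurable_fun (`]0, +oo[%classic : set (measurableTypeR R)) (EFin \o h).
  by apply/measurable_EFinP; exact: open_continuous_measurable_fun.
have h0 t : 0 <= h t by rewrite divr_ge0 ?sqr_ge0// exprn_ge0// ltW.
apply: (@le_trans _ _ (\int[mu]_(t in `]0%R, +oo[) (B%:E * (h t)%:E))%E).
  apply: ge0_le_integral => //.
  - by case/integrableP : iN.
  - by apply: emeasurable_funM => //; exact: measurable_cst.
  - move=> t; rewrite /= in_itv/= andbT => t0; rewrite -EFinM lee_fin -mulrBl.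
    exact: riesz_integrand_le.
rewrite ge0_integralZl//; last by move=> t _; rewrite lee_fin.
rewrite -[leRHS]mule1; apply: lee_wpmul2l; first by rewrite lee_fin.
exact: integral0y_cauchy_le.
Qed.

End riesz.

Theorem theoremA1 (R : realType) (d : nat) (hd : (0 < d)%N) :
  (forall sigma : R, - (d%:R / 2) < sigma -> sigma < 1 -> sigma != 0 ->
     forall x : 'rV[int]_d, kappa sigma x \is a fin_num) /\
  exists C : R, exists M : R,
    forall sigma : R, - (d%:R / 2) < sigma -> sigma < 1 -> sigma != 0 ->
    forall x : 'rV[int]_d, M <= enorm R x ->
      `| fine (kappa sigma x) - Cconst d sigma * powR (enorm R x) (- d%:R - 2 * sigma) |
        <= C * powR (enorm R x) (- d%:R - 2 * sigma - 2).
Proof.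
split=> [sigma sd s1 sn0 x|].
  have [x0|x0] := eqVneq x 0; last by rewrite kappaE//; right.
  have [s0|s0] := ltP sigma 0; first by rewrite kappaE//; left.
  by rewrite /kappa lt0r sn0 s0 s1 x0 eqxx.
(* Both witnesses depend on d only, which is the claimed uniformity in sigma. *)
exists (2 * expR 2 * (4 * Cdif R d)), d.+3%:R => sigma sd s1 sn0 x hx.
exact: riesz_kernel_asymptotics.
Qed.
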